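(* If $(\mathfrak m,\mathfrak n)$ and $(\mathfrak m',\mathfrak n')$ are two equivalent $e$-admissible pairs of $\mathfrak g$, then the algebras $H(\mathfrak m,\mathfrak n)$ and $H(\mathfrak m',\mathfrak n')$ are isomorphic.
   Context: $\mathfrak g$ is a finite-dimensional simple Lie algebra over $\mathbb C$ with Killing form $\langle\cdot,\cdot\rangle$; $e\in\mathfrak g$ is nilpotent, $\chi=\langle e,\cdot\rangle\in\mathfrak g^*$, $\mathfrak g^e$ its centralizer; $\perp$ is with respect to the Killing form. For a grading, $\mathfrak g_{\le k}=\bigoplus_{j\le k}\mathfrak g_j$, $\mathfrak g_{<k}=\bigoplus_{j<k}\mathfrak g_j$; a subspace is graded if it is the direct sum of its intersections with the $\mathfrak g_j$. A pair $(\mathfrak m,\mathfrak n)$ of subalgebras of $\mathfrak g$ is $e$-admissible relative to a $\mathbb Z$-grading $\Gamma:\mathfrak g=\bigoplus_{j\in\mathbb Z}\mathfrak g_j$ if for some integer $a>1$: (A1) $e\in\mathfrak g_a$; (A2) $\mathfrak m,\mathfrak n$ are graded and $\mathfrak g_{\le -a}\subseteq\mathfrak m\subseteq\mathfrak n\subseteq\mathfrak g_{<0}$; (A3) $\mathfrak m^\perp\cap[\mathfrak g,e]=[\mathfrak n,e]$; (A4) $\mathfrak n\cap\mathfrak g^e=\{0\}$; (A5) $[\mathfrak n,\mathfrak m]\subseteq\mathfrak m$; (A6) $\dim\mathfrak m+\dim\mathfrak n=\dim\mathfrak g-\dim\mathfrak g^e$. It is $e$-admissible if it is so relative to some $\mathbb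 Z$-grading. Two $e$-admissible pairs $(\mathfrak m,\mathfrak n)$, $(\mathfrak m',\mathfrak n')$ are comparable if there is a $\mathbb Z$-grading $\Gamma$ relative to which both are $e$-admissible and either $\mathfrak m\subseteq\mathfrak m'\subseteq\mathfrak n'\subseteq\mathfrak n$ or $\mathfrak m'\subseteq\mathfrak m\subseteq\mathfrak n\subseteq\mathfrak n'$. Two $e$-admissible pairs are equivalent if they are joined by a finite sequence of $e$-admissible pairs in which any two consecutive ones are comparable. $W$-algebra: $I(\mathfrak m)$ is the left ideal of $U(\mathfrak g)$ generated by the $x-\chi(x)$, $x\in\mathfrak m$; $Q(\mathfrak m)=U(\mathfrak g)/I(\mathfrak m)$; the adjoint action of $\mathfrak n$ on $U(\mathfrak g)$ stabilizes $I(\mathfrak m)$, hence induces an action on $Q(\mathfrak m)$, and $H(\mathfrak m,\mathfrak n)=Q(\mathfrak m)^{\mathrm{ad}\,\mathfrak n}$ with product $(u+I(\mathfrak m))(v+I(\mathfrak m))=uv+I(\mathfrak m)$. *)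

(* Defs.v *)
From HB Require Import structures.
From mathcomp Require Import all_boot all_order all_algebra.
From mathcomp Require Import ring_quotient generic_quotient.
From mathcomp Require Import boolp finmap.
From mathcomp.multinomials Require Import monalg.

Set Implicit Arguments.
Unset Strict Implicit.
Unset Printing Implicit Defensive.

Import Order.TTheory GRing.Theory Num.Theory.
Local Open Scope ring_scope.
Local Open Scope quotient_scope.

Reserved Notation "[ 'lie' x , y ]" (at level 0, format "[ 'lie'  x ,  y ]").

HB.mixin Record isLieAlgebra (K : fieldType) g of Vector K g := {
  lie : g -> g -> g;
  lie_linear_l : forall y, linear (lie^~ y);
  lie_linear_r : forall x, linear (lie x);
  liexx : forall x, lie x x = 0;
  lie_jacobi : forall x y z,
    lie x (lie y z) + lie y (lie z x) + lie z (lie x y) = 0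
}.

(* Vector makes every lieAlgType finite-dimensional. *)
#[short(type="lieAlgType")]
HB.structure Definition LieAlgebra (K : fieldType) :=
  {g of isLieAlgebra K g & Vector K g}.

Notation "[ 'lie' x , y ]" := (lie x y) : ring_scope.


Section LieAlgebraTheory.
Variables (K : fieldType) (g : lieAlgType K).
Implicit Types (x y z e : g) (h : {vspace g}).

HB.instance Definition _ x := GRing.isLinear.Build K g g *:%R (lie x)
  (lie_linear_r x).

Definition lie_subalgebra h :=
  forall x y, x \in h -> y \in h -> [lie x, y] \in h.

Definition lie_ideal h := forall x y, y \in h -> [lie x, y] \in h.

Definition lie_simple :=
  (exists x y, [lie x, y] != 0) /\
  (forall h, lie_ideal h -> h = 0%VS \/ h = fullv).

Definition ad x : 'End(g) := linfun (lie x).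

Definition ad_nilpotent e := exists k, iter k (comp_lfun (ad e)) \1%VF = 0.

Definition lftrace (f : 'End(g)) : K :=
  \tr (passmx.mxof (vbasis fullv) (vbasis fullv) f).

Definition killing x y : K := lftrace (ad x \o ad y)%VF.

Definition killing_orthogonal h x := forall y, y \in h -> killing x y = 0.

Definition centralizer e : {vspace g} := lker (ad e).

Lemma lie0l y : [lie 0, y] = 0.
Proof.
have /(_ (-1) 0 0) := lie_linear_l y.
by rewrite scaler0 addr0 scaleN1r addNr.
Qed.

Lemma lieDl x x' y : [lie x + x', y] = [lie x, y] + [lie x', y].
Proof. by have /(_ 1 x x') := lie_linear_l y; rewrite !scale1r. Qed.

Lemma lieC x y : [lie x, y] = - [lie y, x].
Proof.
apply/eqP; rewrite -addr_eq0; have := liexx (x + y).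
by rewrite lieDl !linearD /= !liexx add0r addr0 => ->.
Qed.

Lemma adE x y : ad x y = [lie x, y].
Proof. by rewrite lfunE. Qed.

Lemma ad_lie x y : ad [lie x, y] = (ad x \o ad y)%VF - (ad y \o ad x)%VF.
Proof.
apply/lfunP => z; rewrite add_lfunE opp_lfunE !comp_lfunE !adE.
have := lie_jacobi x y z.
rewrite (lieC z [lie x, y]) (lieC z x) linearN /=.
by move=> /eqP; rewrite subr_eq0 => /eqP.
Qed.

Lemma lftraceB (f f' : 'End(g)) : lftrace (f - f') = lftrace f - lftrace f'.
Proof.
rewrite addrC -scaleN1r /lftrace passmx.mxof_linear mxtraceD mxtraceZ mulN1r.
exact: addrC.
Qed.

Lemma lftraceC (f f' : 'End(g)) : lftrace (f \o f')%VF = lftrace (f' \o f)%VF.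
Proof.
have hb : basis_of {:g} (vbasis {:g}) by exact: vbasisP.
by rewrite /lftrace !(passmx.mxof_comp _ _ hb) mxtrace_mulC.
Qed.

Lemma killing_sym x y : killing x y = killing y x.
Proof. exact: lftraceC. Qed.

Lemma killingNl x y : killing (- x) y = - killing x y.
Proof.
have -> : killing (- x) y = lftrace (0 - (ad x \o ad y))%VF; last first.
  by rewrite lftraceB -(subrr 0) lftraceB subrr add0r.
congr lftrace; apply/lfunP => z; rewrite sub0r opp_lfunE !comp_lfunE !adE.
by rewrite lieC linearN /= -lieC.
Qed.

Lemma killing_lie x y z : killing [lie x, y] z = killing x [lie y, z].
Proof.
rewrite /killing !ad_lie comp_lfunDl comp_lfunDr comp_lfunNl comp_lfunNr.
rewrite !lftraceB -!comp_lfunA; congr (_ - _).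
by rewrite lftraceC comp_lfunA.
Qed.

End LieAlgebraTheory.

Section Grading.
Variables (K : fieldType) (g : lieAlgType K).

(* A Z-grading of a finite-dimensional Lie algebra has finitely many nonzero
   components: [grading_supp] lists finitely many degrees containing all of
   theirs, so that the direct sum over Z is a sum over this list. *)
Record grading := Grading {
  grading_comp :> int -> {vspace g};
  grading_supp : seq int;
  grading_supp_uniq : uniq grading_supp;
  grading_out : forall j, j \notin grading_supp -> grading_comp j = 0%VS;
  grading_direct : directv (\sum_(j <- grading_supp) grading_comp j)%VS;
  grading_full : (\sum_(j <- grading_supp) grading_comp j)%VS = fullv;
  grading_lie : forall i j x y,
    x \in grading_comp i -> y \in grading_comp j ->
    [lie x, y] \in grading_comp (i + j)
}.

Variable G : grading.

Definition grading_le (k : int) : {vspace g} :=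
  (\sum_(j <- grading_supp G | (j <= k)%R) G j)%VS.

Definition grading_lt (k : int) : {vspace g} :=
  (\sum_(j <- grading_supp G | (j < k)%R) G j)%VS.

Definition graded_subspace (h : {vspace g}) :=
  h = (\sum_(j <- grading_supp G) (h :&: G j))%VS.

End Grading.

Section AdmissiblePairs.
Variables (K : fieldType) (g : lieAlgType K) (e : g).
Implicit Types (m n : {vspace g}) (G : grading g).

Definition admissible_rel G m n :=
  exists a : int,
    [/\ 1 < a,
        e \in G a,
        [/\ graded_subspace G m, graded_subspace G n,
            (grading_le G (- a) <= m)%VS, (m <= n)%VS &
            (n <= grading_lt G 0)%VS],
        forall x,
          (killing_orthogonal m x /\ exists y, x = [lie y, e]) <->
          (exists2 y, y \in n & x = [lie y, e]) &
        [/\ (n :&: centralizer e = 0)%VS,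
            forall x y, x \in n -> y \in m -> [lie x, y] \in m &
            (\dim m + \dim n = \dim {:g} - \dim (centralizer e))%N]].

Record admissible_pair := AdmissiblePair {
  adm_m : {vspace g};
  adm_n : {vspace g};
  adm_m_subalgebra : lie_subalgebra adm_m;
  adm_n_subalgebra : lie_subalgebra adm_n;
  adm_rel : exists G, admissible_rel G adm_m adm_n
}.

Implicit Types p : admissible_pair.

Definition comparable_pairs p p' :=
  exists G,
    [/\ admissible_rel G (adm_m p) (adm_n p),
        admissible_rel G (adm_m p') (adm_n p') &
        [/\ (adm_m p <= adm_m p')%VS, (adm_m p' <= adm_n p')%VS &
            (adm_n p' <= adm_n p)%VS] \/
        [/\ (adm_m p' <= adm_m p)%VS, (adm_m p <= adm_n p)%VS &
            (adm_n p <= adm_n p')%VS]].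

Definition equivalent_pairs p p' :=
  exists (l : nat) (q : nat -> admissible_pair),
    [/\ q 0%N = p, q l = p' &
        forall i, (i < l)%N -> comparable_pairs (q i) (q i.+1)].

Lemma adm_mn p : (adm_m p <= adm_n p)%VS.
Proof. by have [G [a [_ _ []]]] := adm_rel p. Qed.

Lemma adm_lie p x y : x \in adm_n p -> y \in adm_m p -> [lie x, y] \in adm_m p.
Proof. by have [G [a [_ _ _ _ [_ + _]]]] := adm_rel p; apply. Qed.

Lemma adm_chi p x y :
  x \in adm_n p -> y \in adm_m p -> killing e [lie x, y] = 0.
Proof.
move=> xn ym; have [G [a [_ _ _ A3 _]]] := adm_rel p.
have [_ /(_ (ex_intro2 _ _ x xn erefl)) [xe _]] := A3 [lie x, e].
by rewrite -killing_lie lieC killingNl xe ?oppr0.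
Qed.

End AdmissiblePairs.

Section GeneratedIdeals.
Variables (A : pzRingType) (S : A -> Prop).

Inductive left_ideal_gen : A -> Prop :=
| left_ideal_mem s of S s : left_ideal_gen s
| left_ideal0 : left_ideal_gen 0
| left_idealD u v of left_ideal_gen u & left_ideal_gen v :
    left_ideal_gen (u + v)
| left_idealM a u of left_ideal_gen u : left_ideal_gen (a * u).

Inductive ideal_gen : A -> Prop :=
| ideal_mem s of S s : ideal_gen s
| ideal0 : ideal_gen 0
| idealD u v of ideal_gen u & ideal_gen v : ideal_gen (u + v)
| idealMM a b u of ideal_gen u : ideal_gen (a * u * b).

End GeneratedIdeals.

Section Commutators.
Variables (K : fieldType) (A : algType K).
Implicit Types a u v x y : A.

Lemma commrM_subproof x a u :
  x * (a * u) - a * u * x = (x * a - a * x) * u + a * (x * u - u * x).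
Proof. by rewrite mulrBl mulrBr !mulrA addrA subrK. Qed.

Lemma commrB_subproof x u v :
  x * u - u * x - (x * v - v * x) = x * (u - v) - (u - v) * x.
Proof.
by rewrite mulrBr mulrBl !opprB [v * x - _]addrC addrACA [- (u * x) + _]addrC.
Qed.

Lemma commrD_subproof x u v :
  x * (u + v) - (u + v) * x = (x * u - u * x) + (x * v - v * x).
Proof. by rewrite mulrDr mulrDl opprD addrACA. Qed.

Lemma commrZ_subproof x c u :
  x * (c *: u) - c *: u * x = c *: (x * u - u * x).
Proof. by rewrite scalerBr scalerAr scalerAl. Qed.

Lemma commr_shift_subproof x y c :
  x * (y - c%:A) - (y - c%:A) * x = x * y - y * x.
Proof.
by rewrite -commrB_subproof -scalerAr -scalerAl mulr1 mul1r subrr subr0.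
Qed.

Lemma shift_comm_subproof y v c :
  (y - c%:A) * v = (y * v - v * y) + v * (y - c%:A).
Proof.
by rewrite mulrBl mulrBr -scalerAr -scalerAl mulr1 mul1r addrA subrK.
Qed.

Lemma mul_diff_subproof u v x y :
  x * y - u * v = x * (y - v) + (x - u) * v.
Proof. by rewrite mulrBl mulrBr addrA subrK. Qed.

End Commutators.

Section MalgComplements.
Variables (M : monomType) (K : fieldType).
Implicit Types t u : {malg K[M]}.

Lemma malg_coef1M t u : (t * u)@_mone = t@_mone * u@_mone.
Proof. exact: (mcoeff1g_is_multiplicative _ _).1. Qed.

Lemma malg_coef1_comm t u : t@_mone = 0 -> (t * u - u * t)@_mone = 0.
Proof.
by move=> t0; rewrite mcoeffB (malg_coef1M t) (malg_coef1M u) t0 mul0r mulr0 subrr.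
Qed.

Lemma malg_scaleAr c t u : c *: (t * u) = t * (c *: u).
Proof.
apply/malgP => k; rewrite mcoeffZ mcoeffMl.
rewrite (@mcoeffMlw _ _ (msupp t) (msupp u)) ?msuppZ_le // mulr_sumr.
apply: eq_bigr => k1 _; rewrite mulr_sumr; apply: eq_bigr => k2 _.
by rewrite mcoeffZ mulrnAr mulrCA.
Qed.

End MalgComplements.

Section EnvelopingAlgebra.
Variables (K : fieldType) (g : lieAlgType K).

(* The free associative unital algebra on the underlying set of g; the relations
   env_relD and env_relZ turn it into the tensor algebra of g. *)
Definition free_alg := {malg K[{fmonom g}]}.

Definition free_gen (x : g) : free_alg := << fmu x >>.

Inductive env_rel : free_alg -> Prop :=
| env_relD x y : env_rel (free_gen (x + y) - (free_gen x + free_gen y))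
| env_relZ a x : env_rel (free_gen (a *: x) - a *: free_gen x)
| env_rel_lie x y :
    env_rel (free_gen x * free_gen y - free_gen y * free_gen x
             - free_gen [lie x, y]).

Definition env_ideal : {pred free_alg} := fun t => `[< ideal_gen env_rel t >].

Lemma env_idealP t : reflect (ideal_gen env_rel t) (t \in env_ideal).
Proof. exact: asboolP. Qed.

Lemma env_idealMl a t : t \in env_ideal -> a * t \in env_ideal.
Proof.
by move=> /env_idealP It; apply/env_idealP; rewrite -[_ * _]mulr1; apply: idealMM.
Qed.

Lemma env_idealMr a t : t \in env_ideal -> t * a \in env_ideal.
Proof.
by move=> /env_idealP It; apply/env_idealP; rewrite -[t]mul1r; apply: idealMM.
Qed.

Lemma env_ideal_zmod : zmod_closed env_ideal.
Proof.
split=> [|t u /env_idealP It Iu]; first by apply/env_idealP/ideal0.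
apply/env_idealP; apply: idealD => //.
by rewrite -mulN1r; apply/env_idealP/env_idealMl.
Qed.

HB.instance Definition _ :=
  GRing.isZmodClosed.Build free_alg env_ideal env_ideal_zmod.

Definition envalg := Quotient.quot env_ideal.

HB.instance Definition _ := Choice.on envalg.
HB.instance Definition _ := GRing.Zmodule.on envalg.
HB.instance Definition _ := EqQuotient.on envalg.

Definition env_pi (t : free_alg) : envalg := \pi t.

Definition env_one : envalg := env_pi 1.
Definition env_mul : envalg -> envalg -> envalg := lift_op2 envalg *%R.
Definition env_scale (c : K) : envalg -> envalg := lift_op1 envalg ( *:%R c).

Lemma env_pi_eq t u : (env_pi t = env_pi u) <-> (t - u \in env_ideal).
Proof. by rewrite Quotient.idealrBE; split=> /eqP. Qed.

Lemma env_piP (a : envalg) : exists t, a = env_pi t.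
Proof. by exists (repr a); rewrite /env_pi reprK. Qed.

Lemma env_repr t : repr (env_pi t) - t \in env_ideal.
Proof. by apply/env_pi_eq; rewrite /env_pi reprK. Qed.

Lemma env_piD t u : env_pi (t + u) = env_pi t + env_pi u.
Proof. by rewrite /env_pi !piE. Qed.

Lemma env_piM_subproof t u : env_mul (env_pi t) (env_pi u) = env_pi (t * u).
Proof.
rewrite /env_mul; unlock.
apply/env_pi_eq; set t' := repr _; set u' := repr _.
have -> : t' * u' - t * u = (t' - t) * u' + t * (u' - u).
  by rewrite mulrBl mulrBr addrA subrK.
by apply: rpredD; [apply: env_idealMr|apply: env_idealMl]; apply: env_repr.
Qed.

Lemma env_piZ_subproof c t : env_scale c (env_pi t) = env_pi (c *: t).
Proof.
rewrite /env_scale; unlock.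
apply/env_pi_eq; rewrite -scalerBr -[_ - _]mul1r scalerAl.
exact/env_idealMl/env_repr.
Qed.

Lemma env_mulA : associative env_mul.
Proof.
move=> a b c; have [[[t ->] [u ->]] [v ->]] := (env_piP a, env_piP b, env_piP c).
by rewrite !env_piM_subproof mulrA.
Qed.

Lemma env_mul1l : left_id env_one env_mul.
Proof. by move=> a; have [t ->] := env_piP a; rewrite env_piM_subproof mul1r. Qed.

Lemma env_mul1r : right_id env_one env_mul.
Proof. by move=> a; have [t ->] := env_piP a; rewrite env_piM_subproof mulr1. Qed.

Lemma env_mulDl : left_distributive env_mul +%R.
Proof.
move=> a b c; have [[[t ->] [u ->]] [v ->]] := (env_piP a, env_piP b, env_piP c).
by rewrite !(env_piM_subproof, =^~ env_piD) mulrDl.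
Qed.

Lemma env_mulDr : right_distributive env_mul +%R.
Proof.
move=> a b c; have [[[t ->] [u ->]] [v ->]] := (env_piP a, env_piP b, env_piP c).
by rewrite !(env_piM_subproof, =^~ env_piD) mulrDr.
Qed.

(* The constant coefficient kills the defining relations, so 1 is not in the
   ideal. *)
Lemma env_ideal_coef t : t \in env_ideal -> t@_(mone : {fmonom g}) = 0.
Proof.
have gen0 x : (free_gen x)@_(mone : {fmonom g}) = 0.
  by rewrite /free_gen mcoeffU1 fmP fm1 fmuE.
pose coefM := @malg_coef1M {fmonom g} K.
move=> /env_idealP; elim=> {t} [_ [x y|a x|x y]| |t u _ It _ Iu|a b t _ It].
- by rewrite mcoeffB mcoeffD !gen0 addr0 subrr.
- by rewrite mcoeffB mcoeffZ !gen0 mulr0 subrr.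
- by rewrite mcoeffB (malg_coef1_comm (free_gen y) (gen0 x)) gen0 subrr.
- by rewrite mcoeff0.
- by rewrite mcoeffD It Iu addr0.
- by rewrite (coefM (a * t)) (coefM a t) It mulr0 mul0r.
Qed.

Lemma env_oner_neq0 : env_one != 0.
Proof.
apply/eqP => /eqP; have -> : (0 : envalg) = env_pi 0 by rewrite /env_pi !piE.
move=> /eqP/env_pi_eq; rewrite subr0 => /env_ideal_coef/eqP.
by rewrite mcoeff1 eqxx oner_eq0.
Qed.

HB.instance Definition _ := GRing.Zmodule_isNzRing.Build envalg
  env_mulA env_mul1l env_mul1r env_mulDl env_mulDr env_oner_neq0.

Lemma env_piM t u : env_pi (t * u) = env_pi t * env_pi u.
Proof. by rewrite -env_piM_subproof. Qed.

Lemma env_scaleA c d a : env_scale c (env_scale d a) = env_scale (c * d) a.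
Proof. by have [t ->] := env_piP a; rewrite !env_piZ_subproof scalerA. Qed.

Lemma env_scale1 : left_id 1 env_scale.
Proof. by move=> a; have [t ->] := env_piP a; rewrite env_piZ_subproof scale1r. Qed.

Lemma env_scaleDr : right_distributive env_scale +%R.
Proof.
move=> c a b; have [[t ->] [u ->]] := (env_piP a, env_piP b).
by rewrite !(env_piZ_subproof, =^~ env_piD) scalerDr.
Qed.

Lemma env_scaleDl a : {morph env_scale^~ a : c d / c + d}.
Proof.
move=> c d; have [t ->] := env_piP a.
by rewrite !(env_piZ_subproof, =^~ env_piD) scalerDl.
Qed.

HB.instance Definition _ := GRing.Zmodule_isLmodule.Build K envalg
  env_scaleA env_scale1 env_scaleDr env_scaleDl.

Lemma env_piZ c t : env_pi (c *: t) = c *: env_pi t.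
Proof. by rewrite -env_piZ_subproof. Qed.

Lemma env_scaleAl c (a b : envalg) : c *: (a * b) = (c *: a) * b.
Proof.
have [[t ->] [u ->]] := (env_piP a, env_piP b).
by rewrite -!(env_piM, env_piZ) scalerAl.
Qed.

HB.instance Definition _ := GRing.Lmodule_isLalgebra.Build K envalg env_scaleAl.

Lemma env_scaleAr c (a b : envalg) : c *: (a * b) = a * (c *: b).
Proof.
have [[t ->] [u ->]] := (env_piP a, env_piP b).
by rewrite -!(env_piM, env_piZ) malg_scaleAr.
Qed.

HB.instance Definition _ := GRing.Lalgebra_isAlgebra.Build K envalg env_scaleAr.

Definition env_in (x : g) : envalg := env_pi (free_gen x).

Lemma env_in_lie x y :
  env_in [lie x, y] = env_in x * env_in y - env_in y * env_in x.
Proof.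
have piN t : env_pi (- t) = - env_pi t by rewrite /env_pi !piE.
rewrite /env_in -!env_piM -piN -env_piD; apply/esym/env_pi_eq/env_idealP.
exact/ideal_mem/env_rel_lie.
Qed.

Lemma env_in_linear : linear env_in.
Proof.
move=> a x y; rewrite /env_in.
have -> : env_pi (free_gen (a *: x + y)) =
          env_pi (free_gen (a *: x) + free_gen y).
  exact/env_pi_eq/env_idealP/ideal_mem/env_relD.
rewrite env_piD -env_piZ; congr (_ + _).
exact/env_pi_eq/env_idealP/ideal_mem/env_relZ.
Qed.

HB.instance Definition _ := GRing.isLinear.Build K g envalg *:%R env_in
  env_in_linear.

End EnvelopingAlgebra.

Section WAlgebra.
Variables (K : fieldType) (g : lieAlgType K) (e : g).
Local Notation U := (envalg g).
Local Notation chi := (killing e).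
Implicit Types (m : {vspace g}) (p : admissible_pair e) (u v : U).

Definition whittaker_gen m u :=
  exists2 x, x \in m & u = env_in x - (chi x)%:A.

Definition Iideal m : {pred U} :=
  fun u => `[< left_ideal_gen (whittaker_gen m) u >].

Lemma IidealP m u : reflect (left_ideal_gen (whittaker_gen m) u) (u \in Iideal m).
Proof. exact: asboolP. Qed.

Lemma IidealM m u v : v \in Iideal m -> u * v \in Iideal m.
Proof. by move=> /IidealP Iv; apply/IidealP/left_idealM. Qed.

Lemma Iideal_zmod m : zmod_closed (Iideal m).
Proof.
split=> [|u v /IidealP Iu Iv]; first exact/IidealP/left_ideal0.
by apply/IidealP/left_idealD => //; rewrite -mulN1r; apply/IidealP/IidealM.
Qed.

HB.instance Definition _ m :=
  GRing.isZmodClosed.Build U (Iideal m) (Iideal_zmod m).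

Definition Qmodule m := Quotient.quot (Iideal m).

HB.instance Definition _ m := Choice.on (Qmodule m).
HB.instance Definition _ m := GRing.Zmodule.on (Qmodule m).
HB.instance Definition _ m := EqQuotient.on (Qmodule m).

Definition Qpi m u : Qmodule m := \pi u.

Definition Qscale m (c : K) : Qmodule m -> Qmodule m :=
  lift_op1 (Qmodule m) ( *:%R c).

(* The action of x on Q(m) induced by ad x on U(g), computed on
   representatives; it does not depend on them when ad x stabilizes I(m). *)
Definition Qad m (x : g) : Qmodule m -> Qmodule m :=
  lift_op1 (Qmodule m) (fun u => env_in x * u - u * env_in x).

Lemma Qpi_eq m u v : (Qpi m u = Qpi m v) <-> (u - v \in Iideal m).
Proof. by rewrite Quotient.idealrBE; split=> /eqP. Qed.

Lemma Qpi_eq0 m u : (Qpi m u = 0) <-> (u \in Iideal m).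
Proof.
have -> : (0 : Qmodule m) = Qpi m 0 by rewrite /Qpi !piE.
by rewrite -[X in X \in _]subr0; apply: Qpi_eq.
Qed.

Lemma QpiP m (q : Qmodule m) : exists u, q = Qpi m u.
Proof. by exists (repr q); rewrite /Qpi reprK. Qed.

Lemma Qrepr m u : repr (Qpi m u) - u \in Iideal m.
Proof. by apply/Qpi_eq; rewrite /Qpi reprK. Qed.

Lemma QpiD m u v : Qpi m (u + v) = Qpi m u + Qpi m v.
Proof. by rewrite /Qpi !piE. Qed.

Lemma QpiZ_subproof m c u : Qscale c (Qpi m u) = Qpi m (c *: u).
Proof.
rewrite /Qscale; unlock; apply/Qpi_eq.
by rewrite -scalerBr -[_ - _]mul1r scalerAl; apply/IidealM/Qrepr.
Qed.

Lemma Qscale_subproof m :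
  [/\ forall c d (q : Qmodule m), Qscale c (Qscale d q) = Qscale (c * d) q,
      left_id 1 (@Qscale m), right_distributive (@Qscale m) +%R &
      forall q, {morph (@Qscale m)^~ q : c d / c + d}].
Proof.
split=> [c d q|q|c q r|q c d].
- by have [u ->] := QpiP q; rewrite !QpiZ_subproof scalerA.
- by have [u ->] := QpiP q; rewrite QpiZ_subproof scale1r.
- have [[u ->] [v ->]] := (QpiP q, QpiP r).
  by rewrite -QpiD !QpiZ_subproof scalerDr QpiD.
- by have [u ->] := QpiP q; rewrite !QpiZ_subproof scalerDl QpiD.
Qed.

HB.instance Definition _ m := GRing.Zmodule_isLmodule.Build K (Qmodule m)
  (let: And4 h _ _ _ := Qscale_subproof m in h)
  (let: And4 _ h _ _ := Qscale_subproof m in h)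
  (let: And4 _ _ h _ := Qscale_subproof m in h)
  (let: And4 _ _ _ h := Qscale_subproof m in h).

Lemma QpiZ m c u : Qpi m (c *: u) = c *: Qpi m u.
Proof. by rewrite -QpiZ_subproof. Qed.

Lemma Iideal_ad p x u : x \in adm_n p -> u \in Iideal (adm_m p) ->
  env_in x * u - u * env_in x \in Iideal (adm_m p).
Proof.
move=> xn /IidealP; elim=> {u} [_ [y ym ->]| |u v _ Iu _ Iv|a u /IidealP Iu IHu].
- apply/IidealP/left_ideal_mem; exists [lie x, y]; first exact: adm_lie.
  by rewrite (adm_chi xn ym) scale0r subr0 env_in_lie commr_shift_subproof.
- by rewrite mulr0 mul0r subrr rpred0.
- by rewrite commrD_subproof; apply: rpredD.
- by rewrite commrM_subproof; apply: rpredD; apply: IidealM.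
Qed.

Lemma Qad_pi p x u : x \in adm_n p ->
  Qad x (Qpi (adm_m p) u) = Qpi (adm_m p) (env_in x * u - u * env_in x).
Proof.
move=> xn; rewrite /Qad; unlock; apply/Qpi_eq; set u' := repr _.
rewrite commrB_subproof.
exact/Iideal_ad/Qrepr.
Qed.

Definition Qinv p : {pred Qmodule (adm_m p)} :=
  fun q => `[< forall x, x \in adm_n p -> Qad x q = 0 >].

Arguments Qinv p q : clear implicits.

Lemma QinvP p u :
  reflect (forall x, x \in adm_n p ->
             env_in x * u - u * env_in x \in Iideal (adm_m p))
          (Qpi (adm_m p) u \in Qinv p).
Proof.
apply: (iffP (asboolP _)) => hu x xn; first by rewrite -Qpi_eq0 -Qad_pi // hu.
by rewrite Qad_pi // Qpi_eq0 hu.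
Qed.

Lemma Qinv_zmod p : zmod_closed (Qinv p).
Proof.
have Q0 : (0 : Qmodule (adm_m p)) = Qpi _ 0 by rewrite /Qpi !piE.
split=> [|q r]; first by rewrite Q0; apply/QinvP => x _; rewrite mulr0 mul0r subrr rpred0.
have [[u ->] [v ->]] := (QpiP q, QpiP r).
have -> : Qpi (adm_m p) u - Qpi (adm_m p) v = Qpi _ (u - v) by rewrite /Qpi !piE.
move=> /QinvP hu /QinvP hv; apply/QinvP => x xn.
by rewrite -commrB_subproof; apply: rpredB; [apply: hu|apply: hv].
Qed.

Lemma Qinv_scale p : scaler_closed (Qinv p).
Proof.
move=> c q; have [u ->] := QpiP q.
move=> /QinvP hu; rewrite -QpiZ; apply/QinvP => x xn.
rewrite commrZ_subproof -[_ - _]mul1r scalerAl; exact/IidealM/hu.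
Qed.

HB.instance Definition _ p :=
  GRing.isZmodClosed.Build (Qmodule (adm_m p)) (Qinv p) (@Qinv_zmod p).
HB.instance Definition _ p :=
  GRing.isScaleClosed.Build K (Qmodule (adm_m p)) (Qinv p) (@Qinv_scale p).

Record Walg p := WAlg {
  Wval : Qmodule (adm_m p);
  Wval_inv : Wval \in Qinv p
}.

HB.instance Definition _ p := [isSub for @Wval p].
HB.instance Definition _ p := [Choice of Walg p by <:].
HB.instance Definition _ p := [SubChoice_isSubZmodule of Walg p by <:].
HB.instance Definition _ p := [SubZmodule_isSubLmodule of Walg p by <:].

Lemma IidealMinv p u v : u \in Iideal (adm_m p) -> Qpi (adm_m p) v \in Qinv p ->
  u * v \in Iideal (adm_m p).
Proof.
move=> /IidealP Iu /QinvP hv.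
elim: Iu => {u} [_ [y ym ->]| |u w _ Iu _ Iw|a u _ Iu].
- rewrite shift_comm_subproof; apply: rpredD.
    by apply: hv; apply: subvP (adm_mn p) _ ym.
  by apply/IidealM/IidealP/left_ideal_mem; exists y.
- by rewrite mul0r rpred0.
- by rewrite mulrDl; apply: rpredD.
- by rewrite -mulrA; apply: IidealM.
Qed.

Definition Qmul p : Qmodule (adm_m p) -> Qmodule (adm_m p) -> Qmodule (adm_m p) :=
  lift_op2 (Qmodule (adm_m p)) *%R.

Lemma Qmul_pi p u v : Qpi (adm_m p) v \in Qinv p ->
  Qmul (Qpi (adm_m p) u) (Qpi (adm_m p) v) = Qpi (adm_m p) (u * v).
Proof.
move=> hv; rewrite /Qmul; unlock; apply/Qpi_eq.
set u' := repr _; set v' := repr _; rewrite mul_diff_subproof.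
by apply: rpredD; [apply/IidealM/Qrepr|apply: IidealMinv hv; apply: Qrepr].
Qed.

Lemma Qinv1 p : Qpi (adm_m p) 1 \in Qinv p.
Proof. by apply/QinvP => x _; rewrite mulr1 mul1r subrr rpred0. Qed.

Lemma Qinv_mul p (q r : Qmodule (adm_m p)) :
  q \in Qinv p -> r \in Qinv p -> Qmul q r \in Qinv p.
Proof.
have [[u ->] [v ->]] := (QpiP q, QpiP r) => hu hv.
rewrite Qmul_pi //; apply/QinvP => x xn; rewrite commrM_subproof.
apply: rpredD; last by apply: IidealM; move/QinvP: hv; apply.
by apply: IidealMinv hv; move/QinvP: hu; apply.
Qed.

Definition Wone p : Walg p := WAlg (Qinv1 p).

Definition Wmul p (a b : Walg p) : Walg p :=
  WAlg (Qinv_mul (Wval_inv a) (Wval_inv b)).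

Lemma Walg_ind_subproof p (a : Walg p) :
  exists2 u, Wval a = Qpi (adm_m p) u & Qpi (adm_m p) u \in Qinv p.
Proof.
by have [u au] := QpiP (Wval a); exists u => //; rewrite -au Wval_inv.
Qed.

Lemma Wmul_subproof p :
  [/\ associative (@Wmul p), left_id (Wone p) (@Wmul p),
      right_id (Wone p) (@Wmul p), left_distributive (@Wmul p) +%R &
      right_distributive (@Wmul p) +%R].
Proof.
have valD (a b : Walg p) : Wval (a + b) = Wval a + Wval b by exact: (raddfD val).
split=> [a b c|a|a|a b c|a b c]; apply: val_inj; rewrite /= ?valD.
- have [u -> hu] := Walg_ind_subproof a; have [v -> hv] := Walg_ind_subproof b.
  have [w -> hw] := Walg_ind_subproof c.
  have hvw : Qpi (adm_m p) (v * w) \in Qinv p by rewrite -Qmul_pi ?Qinv_mul.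
  by rewrite (Qmul_pi v hw) (Qmul_pi u hvw) (Qmul_pi u hv) (Qmul_pi _ hw) mulrA.
- by have [u -> hu] := Walg_ind_subproof a; rewrite Qmul_pi // mul1r.
- by have [u -> hu] := Walg_ind_subproof a; rewrite Qmul_pi ?Qinv1 // mulr1.
- have [u -> hu] := Walg_ind_subproof a; have [v -> hv] := Walg_ind_subproof b.
  have [w -> hw] := Walg_ind_subproof c.
  by rewrite -QpiD !(Qmul_pi _ hw) mulrDl QpiD.
- have [u -> hu] := Walg_ind_subproof a; have [v -> hv] := Walg_ind_subproof b.
  have [w -> hw] := Walg_ind_subproof c.
  have hvw : Qpi (adm_m p) (v + w) \in Qinv p by rewrite QpiD; apply: rpredD.
  by rewrite -QpiD (Qmul_pi u hvw) (Qmul_pi u hv) (Qmul_pi u hw) mulrDr QpiD.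
Qed.

(* pzRingType does not require 1 != 0; Walg p is nonzero, but only by the
   Poincare-Birkhoff-Witt theorem, so it is not given the algType structure. *)
HB.instance Definition _ p := GRing.Zmodule_isPzRing.Build (Walg p)
  (let: And5 h _ _ _ _ := Wmul_subproof p in h)
  (let: And5 _ h _ _ _ := Wmul_subproof p in h)
  (let: And5 _ _ h _ _ := Wmul_subproof p in h)
  (let: And5 _ _ _ h _ := Wmul_subproof p in h)
  (let: And5 _ _ _ _ h := Wmul_subproof p in h).

Lemma Wval_inj p : injective (@Wval p).
Proof. exact: val_inj. Qed.

Lemma WvalZ p (c : K) (a : Walg p) : Wval (c *: a) = c *: Wval a.
Proof. by []. Qed.

Lemma WvalM p (a b : Walg p) : Wval (a * b) = Qmul (Wval a) (Wval b).
Proof. by []. Qed.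

Lemma Walg_scaleAl p (c : K) (a b : Walg p) : c *: (a * b) = (c *: a) * b.
Proof.
apply: Wval_inj; rewrite WvalZ !WvalM WvalZ.
have [u -> hu] := Walg_ind_subproof a; have [v -> hv] := Walg_ind_subproof b.
by rewrite -QpiZ !(Qmul_pi _ hv) -QpiZ scalerAl.
Qed.

Lemma Walg_scaleAr p (c : K) (a b : Walg p) : c *: (a * b) = a * (c *: b).
Proof.
apply: Wval_inj; rewrite WvalZ !WvalM WvalZ.
have [u -> hu] := Walg_ind_subproof a; have [v -> hv] := Walg_ind_subproof b.
have hcv : Qpi (adm_m p) (c *: v) \in Qinv p by rewrite QpiZ; apply: rpredZ.
by rewrite -QpiZ (Qmul_pi u hcv) (Qmul_pi u hv) -QpiZ scalerAr.
Qed.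

Definition Walg_isomorphic p p' :=
  exists f : Walg p -> Walg p',
    [/\ linear f, monoid_morphism f & bijective f].

End WAlgebra.

(* Main.v *)
Require Import Defs.
From mathcomp Require Import all_boot all_order all_algebra.
From mathcomp Require Import zify boolp reals complex.
From mathcomp.multinomials Require Import monalg.

Set Implicit Arguments.
Unset Strict Implicit.
Unset Printing Implicit Defensive.

Import Order.TTheory GRing.Theory Num.Theory.
Local Open Scope ring_scope.

(** Write B(x, y) = chi([x, y]). For nested pairs m <= m' <= n' <= n relative to
    the same grading, u + I(m) |-> u + I(m') maps H(m, n) to H(m', n'), and it is
    shown to be bijective by adding to a subspace h, initially 0, homogeneous
    elements x of n in order of increasing degree until h = n. Along the way,
    every u' that is (h cap n')-invariant modulo I(m') lifts to an h-invariant u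
    modulo I(m), and the ambiguity of u is I(k), where k is the B-orthogonal of h
    in m'. If the new x lies in n', the lift is corrected by means of the
    surjectivity of ad x on the h-invariants of I(k); otherwise x is B-dual to
    some y in m', and ad x and the right multiplication by y - chi(y) satisfy the
    Weyl relation, so that dividing by y - chi(y) does the same job.

    Surjectivity of ad x comes from [ad x, t] = 1 modulo lower Kazhdan degree,
    for t in g with B(x, t) = 1; only the module structure over such a Weyl
    algebra is used, so that the Poincare-Birkhoff-Witt theorem is not needed.
    Nor is Cartan's criterion: by simplicity the Killing form is nondegenerate or
    zero, and if it is zero then the two pairs coincide. *)

(** * Equalities in abelian groups by reflection *)

Inductive zmod_expr :=
| ZVar of nat
| ZZero
| ZOpp of zmod_expr
| ZAdd of zmod_expr & zmod_expr.

Fixpoint zmod_eval (V : zmodType) (env : seq V) (t : zmod_expr) : V :=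
  match t with
  | ZVar i => nth 0 env i
  | ZZero => 0
  | ZOpp t => - zmod_eval env t
  | ZAdd t u => zmod_eval env t + zmod_eval env u
  end.

Fixpoint zmod_coef (t : zmod_expr) (i : nat) : int :=
  match t with
  | ZVar j => if i == j then 1 else 0
  | ZZero => 0
  | ZOpp t => - zmod_coef t i
  | ZAdd t u => zmod_coef t i + zmod_coef u i
  end.

Lemma zmod_evalE (V : zmodType) (env : seq V) t :
  zmod_eval env t = \sum_(i < size env) env`_i *~ zmod_coef t i.
Proof.
elim: t => [j||t /= ->|t /= -> u ->] /=.
- have [lt_j|ge_j] := ltnP j (size env).
    rewrite (bigD1 (Ordinal lt_j)) //= eqxx big1 ?addr0 // => i /negPf ne.
    by rewrite -val_eqE /= in ne; rewrite ne.
  rewrite nth_default // big1 // => i _.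
  by rewrite ltn_eqF // (leq_trans (ltn_ord i)).
- by rewrite big1 // => i _; rewrite mulr0z.
- by rewrite -sumrN; apply: eq_bigr => i _; rewrite mulrNz.
- by rewrite -big_split; apply: eq_bigr => i _; rewrite mulrzDr.
Qed.

Lemma zmod_eval_eq (V : zmodType) (env : seq V) t u :
  all (fun i => zmod_coef t i == zmod_coef u i) (iota 0 (size env)) ->
  zmod_eval env t = zmod_eval env u.
Proof.
move=> /allP eq_tu; rewrite !zmod_evalE; apply: eq_bigr => i _; congr (_ *~ _).
by apply/eqP/eq_tu; rewrite mem_iota /=.
Qed.

Ltac zmod_mem eqt a l :=
  lazymatch l with
  | nil => constr:(false)
  | cons ?b ?l' => match constr:(Set) with
    | _ => let __ := match goal with _ => eqt a b end in constr:(true)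
    | _ => zmod_mem eqt a l'
    end
  end.

Ltac zmod_atoms eqt t l :=
  lazymatch t with
  | @GRing.add _ ?a ?b => let l' := zmod_atoms eqt a l in zmod_atoms eqt b l'
  | @GRing.opp _ ?a => zmod_atoms eqt a l
  | @GRing.zero _ => l
  | _ => match zmod_mem eqt t l with true => l | false => constr:(t :: l) end
  end.

Ltac zmod_index eqt a l :=
  lazymatch l with
  | cons ?b ?l' => match constr:(Set) with
    | _ => let __ := match goal with _ => eqt a b end in constr:(0%N)
    | _ => let n := zmod_index eqt a l' in constr:(S n)
    end
  end.

Ltac zmod_reify eqt t l :=
  lazymatch t with
  | @GRing.add _ ?a ?b =>
    let ra := zmod_reify eqt a l in let rb := zmod_reify eqt b l in constr:(ZAdd ra rb)
  | @GRing.opp _ ?a => let ra := zmod_reify eqt a l in constr:(ZOpp ra)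
  | @GRing.zero _ => constr:(ZZero)
  | _ => let n := zmod_index eqt t l in constr:(ZVar n)
  end.

Ltac zmod_by eqt :=
  lazymatch goal with |- @eq ?T ?a ?b =>
    let l := zmod_atoms eqt a (@nil T) in
    let l := zmod_atoms eqt b l in
    let ra := zmod_reify eqt a l in
    let rb := zmod_reify eqt b l in
    let H := fresh in
    have H := @zmod_eval_eq _ l ra rb isT; exact: H
  end.

(* The fallback identifies atoms carrying convertible but distinct structure instances. *)
Ltac zmod :=
  first [ zmod_by ltac:(fun a b => constr_eq a b)
        | zmod_by ltac:(fun a b => unify a b) ].

(* [lia] preprocesses the whole context, hence the clearing. *)
Ltac int_lia :=
  repeat match goal with H : ?T |- _ =>
    lazymatch T with
    | int => fail
    | nat => fail
    | is_true (@Order.le _ _ _ _) => fail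
    | is_true (@Order.lt _ _ _ _) => fail
    | is_true (leq _ _) => fail
    | is_true (~~ (@eq_op _ (_ : int) _)) => fail
    | @eq int _ _ => fail
    | _ => clear H
    end
  end; lia.

(** * Subspaces as predicates, and linear functions *)

Section LinearPredicates.
Variables (K : fieldType) (V : lmodType K).

(** Subspaces are predicates here because the enveloping algebra need not be finite-dimensional. *)
Definition linear_pred (P : V -> Prop) :=
  P 0 /\ forall c u v, P u -> P v -> P (c *: u + v).

Variables (P : V -> Prop) (Plin : linear_pred P).

Lemma linear_predD u v : P u -> P v -> P (u + v).
Proof. by move=> Pu Pv; rewrite -[u]scale1r; apply: Plin.2. Qed.

Lemma linear_predZ c u : P u -> P (c *: u).
Proof. by move=> Pu; rewrite -[_ *: u]addr0; apply: Plin.2 => //; apply: Plin.1. Qed.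

Lemma linear_predN u : P u -> P (- u).
Proof. by rewrite -scaleN1r; apply: linear_predZ. Qed.

Lemma linear_predB u v : P u -> P v -> P (u - v).
Proof. by move=> Pu Pv; apply: linear_predD => //; apply: linear_predN. Qed.

Lemma linear_pred_unscale c u : c != 0 -> P (c *: u) -> P u.
Proof. by move=> c0 /(linear_predZ c^-1); rewrite scalerA mulVf ?scale1r. Qed.

End LinearPredicates.

Section LinearFunctions.
Variables (K : fieldType) (V V' : lmodType K).

Lemma linear_fun0 (f : V -> V') : linear f -> f 0 = 0.
Proof.
by move=> linf; rewrite -[X in f X](subrr 0) -scaleN1r addrC linf scaleN1r addNr.
Qed.

Lemma linear_funD (f : V -> V') u v : linear f -> f (u + v) = f u + f v.
Proof. by move=> linf; rewrite -[u in LHS]scale1r linf scale1r. Qed.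

Lemma linear_funZ (f : V -> V') c u : linear f -> f (c *: u) = c *: f u.
Proof. by move=> linf; rewrite -[_ *: u]addr0 linf linear_fun0 // addr0. Qed.

Lemma linear_funB (f : V -> V') u v : linear f -> f (u - v) = f u - f v.
Proof. by move=> linf; rewrite addrC -scaleN1r linf scaleN1r addrC. Qed.

End LinearFunctions.

(** * Surjectivity in filtered Weyl algebra modules *)

Section FilteredSurjectivity.
(** On W, up to lower degree, X lowers and T raises the degree by d, and X T - T X = 1. T need not
    preserve W, whence [liftT]: the leading term of T u is represented in P, where preimages under X
    modulo I are sought. *)
Variables (K : fieldType) (charK : [pchar K] =i pred0) (V : lmodType K).
Variables (I W P : V -> Prop) (F : int -> V -> Prop) (d : int) (X T : V -> V).
Hypotheses (d_gt0 : 0 < d) (linX : linear X) (linT : linear T).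
Hypotheses (linI : linear_pred I) (linW : linear_pred W) (linP : linear_pred P).
Hypotheses (linF : forall q, linear_pred (F q)).
Hypotheses (leF : forall q q' u, q <= q' -> F q u -> F q' u).
Hypotheses (FI : forall q u, q < 0 -> F q u -> I u).
Hypotheses (IF : forall q u, I u -> F q u) (PW : forall u, P u -> W u).
Hypotheses (TI : forall u, I u -> I (T u)).
Hypotheses (XW : forall u, W u -> W (X u)).
Hypotheses (XF : forall q u, F q u -> F (q - d) (X u)).
Hypotheses (TXF : forall q u, W u -> F q u -> F (q - 1) (X (T u) - T (X u) - u)).
Hypotheses (liftT : forall q u, W u -> F q u ->
  exists s, [/\ P s, F (q + d) s & F (q + d - 1) (s - T u)]).

Lemma pchar0_natS (c : nat) : c.+1%:R != 0 :> K.
Proof. by rewrite (pcharf0P K).1. Qed.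

(* In a Weyl algebra (X T + c) T v' = T (X T + c + 1) v', which drives the
   induction; s plays the role of a correction of T v lying in P. *)
Lemma filtered_surjective_shift (N : nat) (q : int) (c : nat) u :
  q < N%:Z -> W u -> F q u ->
  exists v s, [/\ W v, F q v, P s, F (q + d) s &
    F (q + d - 1) (s - T v) /\ I (X s + c%:R *: v - u)].
Proof.
elim: N q c u => [|N IHN] q c u qN Wu Fu.
  have T0 := linear_fun0 linT.
  exists 0, 0; rewrite T0 (linear_fun0 linX) scaler0 !(addr0, sub0r, oppr0).
  split; [exact: linW.1|exact: (linF _).1|exact: linP.1|exact: (linF _).1|].
  split; first exact: (linF _).1.
  by apply: linear_predN => //; apply: FI Fu.
(* If u = (X T + c) v, then X u = (X T + c + 1) X v. So v' and s' play the roles of X v and T X v,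
   and u = T X v + (c + 1) v is solved for v. *)
have [|||v' [s' [Wv' Fv' Ps' Fs' [Fsv' Iv']]]] := IHN (q - d) c.+1 (X u).
- by int_lia.
- exact: XW.
- exact: XF.
rewrite subrK in Fs' Fsv'.
pose v := c.+1%:R^-1 *: (u - s').
have vE : c.+1%:R *: v = u - s' by rewrite scalerA divff ?scale1r ?pchar0_natS.
have Wv : W v by apply: linear_predZ => //; apply: linear_predB => //; apply: PW.
have Fv : F q v by apply: linear_predZ => //; apply: linear_predB.
have [s [Ps Fs Fsv]] := liftT Wv Fv.
have IXv : I (X v - v').
  apply: (linear_pred_unscale linI (pchar0_natS c)).
  rewrite scalerBr -linear_funZ // vE linear_funB //.
  rewrite (_ : _ - _ = - (X s' + c.+1%:R *: v' - X u)); last by zmod.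
  exact: linear_predN.
(* The error r of this approximation has degree at most q - 1, so the induction applies to it. *)
pose r := u - X s - c%:R *: v.
have rE : r = v + s' - X s.
  rewrite /r addrAC; congr (_ - _); rewrite -[u](subrK s') -vE.
  by rewrite mulrSr scalerDl scale1r addrAC [c%:R *: v + v]addrC addrK.
have Wr : W r.
  by apply: linear_predB => //; [apply: linear_predB|apply: linear_predZ] => //; apply/XW/PW.
have Fr : F (q - 1) r.
  have -> : r = - (X (s - T v) + ((X (T v) - T (X v) - v) + (T (X v - v') - (s' - T v')))).
    by rewrite rE !(linear_funB _ _ linX) !(linear_funB _ _ linT); zmod.
  apply: linear_predN => //; apply: linear_predD => //.
    by have := XF Fsv; rewrite (_ : _ - d = q - 1) //; int_lia.
  apply: linear_predD => //; first exact: TXF.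
  by apply: linear_predB => //; apply/IF/TI.
have [|v'' [s'' [Wv'' Fv'' Ps'' Fs'' [Fsv'' Iv'']]]] := IHN (q - 1) c r _ Wr Fr.
  by int_lia.
exists (v + v''), (s + s''); split.
- exact: linear_predD.
- by apply: linear_predD => //; apply: leF Fv''; int_lia.
- exact: linear_predD.
- by apply: linear_predD => //; apply: leF Fs''; int_lia.
split.
  rewrite linear_funD // opprD addrACA; apply: linear_predD => //.
  by apply: leF Fsv''; int_lia.
rewrite linear_funD // scalerDr.
have -> : X s + X s'' + (c%:R *: v + c%:R *: v'') - u = X s'' + c%:R *: v'' - r.
  by rewrite /r; zmod.
by [].
Qed.

Lemma filtered_surjective q u : W u -> F q u ->
  exists s, [/\ P s, F (q + d) s & I (X s - u)].
Proof.
move=> Wu Fu; have qN : q < (`|q|%N.+1)%:Z by int_lia.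
have [v [s [_ _ Ps Fs [_]]]] := filtered_surjective_shift 0 qN Wu Fu.
by rewrite scale0r addr0; exists s.
Qed.

End FilteredSurjectivity.

(** * Gradings and the Killing form *)

Section SubspaceSums.
Variables (K : fieldType) (V : vectType K) (I : eqType).
Implicit Types (r : seq I) (U : I -> {vspace V}).

Lemma memv_sum_seq_ind r (P : pred I) U (Q : V -> Prop) :
  Q 0 -> (forall x y, Q x -> Q y -> Q (x + y)) ->
  (forall i x, i \in r -> P i -> x \in U i -> Q x) ->
  forall x, x \in (\sum_(i <- r | P i) U i)%VS -> Q x.
Proof.
move=> Q0 QD; elim: r => [|i r IHr] QU x.
  by rewrite big_nil memv0 => /eqP ->.
have QU' j y : j \in r -> P j -> y \in U j -> Q y.
  by move=> jr; apply: QU; rewrite inE jr orbT.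
rewrite big_cons; case: ifP => Pi; last exact: IHr.
case/memv_addP => y Uy [z zr ->]; apply: QD; last exact: IHr.
by apply: QU Uy; rewrite ?inE ?eqxx.
Qed.

Lemma sumv_seq_sup r (P : pred I) U i :
  i \in r -> P i -> (U i <= \sum_(j <- r | P j) U j)%VS.
Proof. by move=> ir Pi; rewrite (big_rem i) //= Pi addvSl. Qed.

Lemma directv_seq_unique r U (f h : I -> V) : uniq r ->
  directv (\sum_(i <- r) U i) ->
  (forall i, i \in r -> f i \in U i) -> (forall i, i \in r -> h i \in U i) ->
  \sum_(i <- r) f i = \sum_(i <- r) h i -> forall i, i \in r -> f i = h i.
Proof.
case: r => // i0 r' uniq_r; set r := i0 :: r' in uniq_r *.
rewrite directvE /= !(big_nth i0) !big_mkord => dU fU hU eq_fh i ir.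
have dU' : directv (\sum_(k < size r) U (nth i0 r k)) by rewrite directvE.
have lt_i : (index i r < size r)%N by rewrite index_mem.
have /directv_sum_independent := dU'.
move=> /(_ (fun k => f (nth i0 r k) - h (nth i0 r k))) dU0.
have := dU0 _ _ (Ordinal lt_i) isT; rewrite /= nth_index // => /(_ _ _)/eqP.
rewrite subr_eq0 => eq_i; apply/eqP/eq_i => [k _|].
  by rewrite rpredB ?fU ?hU ?mem_nth.
by rewrite sumrB eq_fh subrr.
Qed.

End SubspaceSums.

Section GradedComponents.
Variables (K : fieldType) (g : lieAlgType K) (G : grading g).
Implicit Types (x y : g) (h : {vspace g}) (i j k l : int).

Definition gproj j : 'End(g) := if j \in grading_supp G then
  sumv_pi (\sum_(j <- grading_supp G) G j)%VS j else 0.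

Lemma gproj_mem j x : gproj j x \in G j.
Proof.
by rewrite /gproj; case: ifP => _; rewrite ?memv_sum_pi // lfunE mem0v.
Qed.

Lemma gproj_sum x : \sum_(j <- grading_supp G) gproj j x = x.
Proof.
rewrite -[RHS](sumv_pi_uniq_sum (erefl (\sum_(j <- grading_supp G) G j)%VS)).
- by apply: eq_big_seq => j jG; rewrite /gproj jG.
- by rewrite filter_predT grading_supp_uniq.
- by rewrite grading_full memvf.
Qed.

Lemma gproj_unique x (f : int -> g) : (forall j, f j \in G j) ->
  x = \sum_(j <- grading_supp G) f j -> forall j, gproj j x = f j.
Proof.
move=> fG defx j; have [jG|jG] := boolP (j \in grading_supp G).
  apply: (@directv_seq_unique _ _ _ _ G (gproj^~ x) f (grading_supp_uniq G)) => //.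
  - exact: grading_direct.
  - by move=> i _; apply: gproj_mem.
  - by rewrite gproj_sum.
by move: (fG j) (gproj_mem j x); rewrite (grading_out jG) !memv0 => /eqP -> /eqP ->.
Qed.

Lemma gproj_homog i j x : x \in G i -> gproj j x = if j == i then x else 0.
Proof.
move=> xi; apply: (gproj_unique (f := fun j => if j == i then x else 0)) => [k|].
  by case: eqP => [->|_]; rewrite ?mem0v.
have [iG|iG] := boolP (i \in grading_supp G).
  rewrite (bigD1_seq i) ?grading_supp_uniq //= eqxx big1 ?addr0 // => k /negPf -> //.
by move: xi; rewrite (grading_out iG) memv0 => /eqP ->; rewrite big1 // => k _; case: ifP.
Qed.

Lemma gproj_graded h x j : graded_subspace G h -> x \in h -> gproj j x \in h.
Proof.
move=> Gh; rewrite {1}Gh; apply: (memv_sum_seq_ind (Q := fun x => gproj j x \in h)).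
- by rewrite linear0 mem0v.
- by move=> y z yh zh; rewrite linearD rpredD.
- move=> i y _ _; rewrite memv_cap => /andP[yh yi].
  by rewrite (gproj_homog _ yi); case: ifP; rewrite ?mem0v.
Qed.

Lemma gproj_ind (Q : g -> Prop) x : Q 0 -> (forall y z, Q y -> Q z -> Q (y + z)) ->
  (forall j, Q (gproj j x)) -> Q x.
Proof. by move=> Q0 QD Qj; rewrite -(gproj_sum x); apply: (big_ind Q) => //. Qed.

Lemma homog_le j k : j <= k -> (G j <= grading_le G k)%VS.
Proof.
move=> jk; have [jG|jG] := boolP (j \in grading_supp G); last by rewrite grading_out ?sub0v.
exact: (@sumv_seq_sup _ _ _ _ (fun i => i <= k)).
Qed.

Lemma grading_le_ind k (Q : g -> Prop) :
  Q 0 -> (forall y z, Q y -> Q z -> Q (y + z)) ->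
  (forall j x, j <= k -> x \in G j -> Q x) ->
  forall x, x \in grading_le G k -> Q x.
Proof.
by move=> Q0 QD Qj; apply: memv_sum_seq_ind => // i x _; apply: Qj.
Qed.

Lemma gproj_le j k x : x \in grading_le G k -> k < j -> gproj j x = 0.
Proof.
move=> xk kj; move: x xk; apply: grading_le_ind; first exact: linear0.
- by move=> y z y0 z0; rewrite linearD /= y0 z0 addr0.
- by move=> i x ik xi; rewrite (gproj_homog _ xi); case: eqP => // ji; lia.
Qed.

Lemma mem_grading_le k x : (forall j, k < j -> gproj j x = 0) -> x \in grading_le G k.
Proof.
move=> x0; rewrite -(gproj_sum x); apply: rpred_sum => j _.
have [kj|jk] := ltP k j; first by rewrite x0 ?mem0v.
exact: subvP (homog_le jk) _ (gproj_mem j x).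
Qed.

Lemma grading_le_homog k x : x \in grading_le G k -> x - gproj k x \in grading_le G (k - 1).
Proof.
move=> xk; apply: mem_grading_le => j kj.
rewrite linearB /= (gproj_homog _ (gproj_mem k x)).
by case: eqP => [->|ne]; rewrite ?subrr // subr0 (gproj_le xk) //; lia.
Qed.

Lemma grading_leS k l : k <= l -> (grading_le G k <= grading_le G l)%VS.
Proof.
move=> kl; apply/subvP => x xk; apply: mem_grading_le => j lj.
by apply: gproj_le xk _; lia.
Qed.

Lemma grading_ltE k : grading_lt G k = grading_le G (k - 1).
Proof. by apply: eq_bigl => j; apply/idP/idP; lia. Qed.

Lemma grading_le_lie k l x y :
  x \in grading_le G k -> y \in grading_le G l -> [lie x, y] \in grading_le G (k + l).
Proof.
move=> + yl; move: x; apply: grading_le_ind.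
- by rewrite lie0l mem0v.
- by move=> x x' xk x'k; rewrite lieDl rpredD.
move=> i x ik xi; move: y yl; apply: grading_le_ind.
- by rewrite linear0 mem0v.
- by move=> y y' yl y'l; rewrite linearD rpredD.
move=> j y jl yj; apply: subvP (homog_le _) _ (grading_lie xi yj); lia.
Qed.

Lemma grading_le_bounded : exists N : nat, forall k, k < - N%:Z -> grading_le G k = 0%VS.
Proof.
exists (\sum_(j <- grading_supp G) `|j|)%N => k kN; apply: big1_seq => j /andP[jk jG].
have : (`|j| <= \sum_(j <- grading_supp G) `|j|)%N by rewrite (big_rem j) //= leq_addr.
by lia.
Qed.

End GradedComponents.

(** * Bilinearity of the Killing form and orthogonality of graded components *)

Section KillingForm.
Variables (K : fieldType) (g : lieAlgType K).
Implicit Types (x y z : g) (h : {vspace g}).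

Lemma lftraceZ a (f : 'End(g)) : lftrace (a *: f) = a * lftrace f.
Proof.
have f0 : lftrace (0 : 'End(g)) = 0 by rewrite -(subrr 0) lftraceB subrr.
move: f0; rewrite -[a *: f]addr0 /lftrace => f0.
by rewrite passmx.mxof_linear mxtraceD mxtraceZ f0 addr0.
Qed.

Lemma killing_linear y : linear (fun x => killing x y : K^o).
Proof.
move=> a x x'; rewrite /killing.
have -> : (ad (a *: x + x') \o ad y)%VF = a *: (ad x \o ad y)%VF + (ad x' \o ad y)%VF.
  apply/lfunP => z; rewrite add_lfunE scale_lfunE !comp_lfunE !adE.
  by have := lie_linear_l [lie y, z] a x x'.
by rewrite /lftrace passmx.mxof_linear mxtraceD mxtraceZ.
Qed.

Lemma killing0l y : killing 0 y = 0.
Proof. exact: linear_fun0 (killing_linear y). Qed.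

Lemma killingDl x x' y : killing (x + x') y = killing x y + killing x' y.
Proof. exact: linear_funD (killing_linear y). Qed.

Lemma killingZl a x y : killing (a *: x) y = a * killing x y.
Proof. exact: linear_funZ (killing_linear y). Qed.

Lemma killing0r x : killing x 0 = 0.
Proof. by rewrite killing_sym killing0l. Qed.

Lemma killingDr x y y' : killing x (y + y') = killing x y + killing x y'.
Proof. by rewrite ![killing x _]killing_sym killingDl. Qed.

Lemma killingZr a x y : killing x (a *: y) = a * killing x y.
Proof. by rewrite ![killing x _]killing_sym killingZl. Qed.

Lemma lieDr x y y' : [lie x, y + y'] = [lie x, y] + [lie x, y'].
Proof. exact: linearD. Qed.

Lemma lieZr a x y : [lie x, a *: y] = a *: [lie x, y].
Proof. exact: linearZ. Qed.

Lemma lieZl a x y : [lie a *: x, y] = a *: [lie x, y].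
Proof. by rewrite lieC lieZr -scalerN -lieC. Qed.

Lemma lieBl x x' y : [lie x - x', y] = [lie x, y] - [lie x', y].
Proof. by rewrite lieDl -scaleN1r lieZl scaleN1r. Qed.

Hypothesis charK : [pchar K] =i pred0.

Lemma pchar0_int (k : int) : k%:~R = 0 :> K -> k = 0.
Proof.
case: k => n; rewrite ?NegzE ?mulrNz -?pmulrn => /eqP.
  by rewrite (pcharf0P K).1 // => /eqP ->.
by rewrite oppr_eq0 (pcharf0P K).1.
Qed.

Variable G : grading g.

(** The Euler derivation of the grading, which acts on g_j as the scalar j. *)
Definition degree_derivation : 'End(g) :=
  \sum_(j <- grading_supp G) j%:~R *: gproj G j.

Lemma degree_derivationE i x : x \in G i -> degree_derivation x = i%:~R *: x.
Proof.
move=> xi; rewrite /degree_derivation sum_lfunE.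
have [iG|iG] := boolP (i \in grading_supp G).
  rewrite (bigD1_seq i) ?grading_supp_uniq //= scale_lfunE (gproj_homog _ xi) eqxx.
  rewrite big1 ?addr0 // => j /negPf ne.
  by rewrite scale_lfunE (gproj_homog _ xi) ne scaler0.
move: xi; rewrite (grading_out iG) memv0 => /eqP ->.
by rewrite big1 ?scaler0 // => j _; rewrite linear0.
Qed.

Lemma ad_degree_derivation i x : x \in G i ->
  (degree_derivation \o ad x)%VF - (ad x \o degree_derivation)%VF = i%:~R *: ad x.
Proof.
move=> xi; apply/lfunP => y; move: y.
have lin : forall y, ((degree_derivation \o ad x)%VF - (ad x \o degree_derivation)%VF
    - i%:~R *: ad x) y = 0.
  move=> y; apply: (@gproj_ind _ _ G (fun y => (_ : 'End(g)) y = 0)).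
  - by rewrite linear0.
  - by move=> u v; rewrite linearD /= => -> ->; rewrite addr0.
  move=> j; set z := gproj G j y; have zj : z \in G j by apply: gproj_mem.
  rewrite !add_lfunE !opp_lfunE scale_lfunE !comp_lfunE !adE.
  rewrite (degree_derivationE zj) (degree_derivationE (grading_lie xi zj)) lieZr.
  by rewrite intrD scalerDl; zmod.
move=> y; apply/eqP; rewrite -subr_eq0; apply/eqP.
by have := lin y; rewrite add_lfunE opp_lfunE.
Qed.

(* Cyclicity of the trace gives (i + j) <x, y> = 0. *)
Lemma killing_homog i j x y : x \in G i -> y \in G j -> i + j != 0 -> killing x y = 0.
Proof.
move=> xi yj ij; set D := degree_derivation.
have trx : i%:~R * killing x y = lftrace (D \o ad x \o ad y)%VF - lftrace (ad x \o D \o ad y)%VF.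
  rewrite -lftraceB /killing -lftraceZ comp_lfunZl -(ad_degree_derivation xi).
  by rewrite comp_lfunDl comp_lfunNl.
have try : j%:~R * killing x y = lftrace (ad x \o D \o ad y)%VF - lftrace (ad x \o ad y \o D)%VF.
  rewrite -lftraceB /killing -lftraceZ comp_lfunZr -(ad_degree_derivation yj).
  by rewrite comp_lfunDr comp_lfunNr !comp_lfunA.
have : (i + j)%:~R * killing x y = 0.
  by rewrite intrD mulrDl trx try -comp_lfunA (lftraceC D) subrKA subrr.
by move=> /eqP; rewrite mulf_eq0 => /orP[/eqP/pchar0_int ij0|/eqP //]; rewrite ij0 eqxx in ij.
Qed.

End KillingForm.

(** * Subspaces and duality in finite dimension *)

Lemma linear_pred_vspace (K : fieldType) (V : vectType K) (P : V -> Prop) :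
  linear_pred P -> exists H : {vspace V}, forall x, (x \in H) <-> P x.
Proof.
(* A subspace H inside P grows by one vector of P at a time; N bounds its codimension. *)
move=> linP; suff: forall (N : nat) (H : {vspace V}), (\dim {:V} - \dim H <= N)%N ->
    (forall x, x \in H -> P x) -> exists H : {vspace V}, forall x, (x \in H) <-> P x.
  move/(_ _ 0%VS (leqnn _)); apply=> x; rewrite memv0 => /eqP ->; exact: linP.1.
elim=> [|N IHN] H dimH HP.
  exists H => x; split=> [|_]; first exact: HP.
  have : (H == fullv) by rewrite eqEdim subvf -subn_eq0 -leqn0.
  by move=> /eqP ->; rewrite memvf.
have [PH|/existsNP[x /not_implyP[Px /negP xH]]] := pselect (forall x, P x -> x \in H).
  by exists H => x; split; [apply: HP|apply: PH].
apply: (IHN (H + <[x]>)%VS) => [|y /memv_addP[u uH [v /vlineP[c ->] ->]]].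
  suff: (\dim H < \dim (H + <[x]>))%N by lia.
  rewrite (ltn_leqif (dimv_leqif_sup (addvSl _ _))) subv_add subvv /=.
  by rewrite -memvE.
by rewrite addrC; apply: linP.2 => //; apply: HP.
Qed.

(** By hypothesis the form b(x, .) on T is none of the b(u, .) with u in H. In bases, the row r is
    outside the row space of M, so some column of the cokernel of M is not killed by r; it gives t
    up to scaling. *)
Lemma linear_form_separation (K : fieldType) (E F : vectType K) (b : E -> F -> K)
    (H : {vspace E}) (T : {vspace F}) x :
  (forall t, linear (fun u => b u t : K^o)) -> (forall u, linear (b u : F -> K^o)) ->
  (forall u, u \in H -> exists2 t, t \in T & b (x - u) t != 0) ->
  exists t, [/\ t \in T, forall u, u \in H -> b u t = 0 & b x t = 1].
Proof.
move=> linl linr sep.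
pose M := \matrix_(i < \dim H, j < \dim T) b (vbasis H)`_i (vbasis T)`_j.
pose r := \row_(j < \dim T) b x (vbasis T)`_j.
have b_sumr u (c : 'I_(\dim T) -> K) :
    b u (\sum_(j < \dim T) c j *: (vbasis T)`_j) = \sum_(j < \dim T) b u (vbasis T)`_j * c j.
  elim/big_ind2: _ => [|y s y' s' <- <-|j _]; first exact: linear_fun0 (linr u).
    exact: linear_funD (linr u).
  by rewrite mulrC; apply: linear_funZ (linr u).
have b_suml t (c : 'I_(\dim H) -> K) :
    b (\sum_(i < \dim H) c i *: (vbasis H)`_i) t = \sum_(i < \dim H) c i * b (vbasis H)`_i t.
  elim/big_ind2: _ => [|y s y' s' <- <-|j _]; first exact: linear_fun0 (linl t).
    exact: linear_funD (linl t).
  exact: linear_funZ (linl t).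
have : ~~ (r <= M)%MS.
  apply/negP => /submxP[D rE].
  have [|t tT] := sep (\sum_(i < \dim H) D 0 i *: (vbasis H)`_i).
    by apply: rpred_sum => i _; rewrite rpredZ // vbasis_mem // mem_nth ?size_tuple.
  rewrite (linear_funB _ _ (linl t)) subr_eq0 => /eqP[]; rewrite b_suml.
  rewrite (coord_vbasis tT) b_sumr.
  under [RHS]eq_bigr => i _ do rewrite b_sumr mulr_sumr.
  rewrite exchange_big; apply: eq_bigr => j _ /=.
  have := congr1 (fun A : 'rV_(\dim T) => A 0 j) rE; rewrite !mxE => ->.
  by rewrite mulr_suml; apply: eq_bigr => i _; rewrite !mxE mulrA.
rewrite submxE => /rV0Pn[k rk0]; pose C := cokermx M.
pose t0 := \sum_(j < \dim T) C j k *: (vbasis T)`_j.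
have bt0 u : b u t0 = \sum_(j < \dim T) b u (vbasis T)`_j * C j k by exact: b_sumr.
have bx : b x t0 != 0.
  suff -> : b x t0 = (r *m C) 0 k by exact: rk0.
  rewrite bt0 mxE; apply: eq_bigr => j _; by rewrite !mxE.
have t0T : t0 \in T.
  by apply: rpred_sum => j _; rewrite rpredZ // vbasis_mem // mem_nth ?size_tuple.
exists ((b x t0)^-1 *: t0); split; first by rewrite rpredZ.
  move=> u /coord_vbasis ->; rewrite (linear_funZ _ _ (linr _)) b_suml big1 ?scaler0 // => i _.
  have MC : (M *m C) i k = 0 by rewrite mulmx_coker mxE.
  suff -> : b (vbasis H)`_i t0 = (M *m C) i k by rewrite MC; apply: mulr0.
  by rewrite bt0 [RHS]mxE; apply: eq_bigr => j _; rewrite !mxE.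
by rewrite (linear_funZ _ _ (linr _)); apply: mulVf.
Qed.

(** * Nondegeneracy of the Killing form *)

Section KillingNondegenerate.
Variables (K : fieldType) (g : lieAlgType K).

Definition killing_nondegenerate :=
  forall x : g, x != 0 -> exists y : g, killing x y != 0.

Lemma killing_degenerate_simple : lie_simple g ->
  killing_nondegenerate \/ forall x y : g, killing x y = 0.
Proof.
move=> [_ simple_g].
have linP : linear_pred (fun x : g => forall y, killing x y = 0).
  split=> [y|c u v u0 v0 y]; first exact: killing0l.
  by rewrite killingDl killingZl u0 v0 mulr0 addr0.
have [H HP] := linear_pred_vspace linP.
have idealH : lie_ideal H.
  move=> x y /HP y0; apply/HP => z.
  by rewrite lieC killingNl killing_lie y0 oppr0.
have [H0|Hf] := simple_g H idealH; last by right=> x; apply/HP; rewrite Hf memvf.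
left=> x x0; have [//|Nx] := pselect (exists y : g, killing x y != 0).
suff : x \in H by rewrite H0 memv0 (negPf x0).
by apply/HP => y; apply/eqP/negPn/negP => xy; apply: Nx; exists y.
Qed.

Lemma killing_separation (H : {vspace g}) x : killing_nondegenerate -> x \notin H ->
  exists t, (forall u, u \in H -> killing u t = 0) /\ killing x t = 1.
Proof.
move=> nondeg xH.
have [|u|u uH|t [_ tH xt]] := @linear_form_separation _ _ _ (@killing _ g) H fullv x.
- exact: killing_linear.
- by move=> c y y'; rewrite killingDr killingZr.
- have [|t] := nondeg (x - u); last by exists t; rewrite ?memvf.
  by rewrite subr_eq0; apply: contraNneq xH => ->.
by exists t.
Qed.

(** If t were outside [e, g], some s orthogonal to [e, g] would have <t, s> = 1. By invariance
    [e, s] is orthogonal to g, so s centralizes e, against the hypothesis on t. *)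
Lemma killing_orthogonal_centralizer (e t : g) : killing_nondegenerate ->
  (forall u, u \in centralizer e -> killing u t = 0) -> exists z, t = [lie z, e].
Proof.
move=> nondeg tP; have [/memv_imgP[z _ ->]|tN] := boolP (t \in (ad e @: fullv)%VS).
  by exists (- z); rewrite adE lieC -scaleN1r -lieZl scaleN1r.
have [s [s_im ts]] := killing_separation nondeg tN.
have s_e : [lie e, s] = 0.
  apply/eqP; apply/negPn/negP => /nondeg[z /eqP[]].
  rewrite killing_lie lieC killing_sym killingNl -killing_sym -killing_lie -adE s_im ?oppr0 //.
  by rewrite memv_img ?memvf.
have := tP s; rewrite killing_sym ts => /(_ _)/eqP; rewrite oner_eq0 => contra.
by have := contra _; rewrite memv_ker adE s_e; move/(_ (eqxx _)).
Qed.

End KillingNondegenerate.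

(** * The form B and admissible pairs *)

Section KirillovForm.
Variables (K : fieldType) (g : lieAlgType K) (e : g).
Implicit Types (x y z : g) (h m n : {vspace g}).

Definition kirillov x y := killing e [lie x, y].

Lemma kirillov_linear_l y : linear (fun x => kirillov x y : K^o).
Proof. by move=> c x x'; rewrite /kirillov lieDl lieZl killingDr killingZr. Qed.

Lemma kirillov_linear_r x : linear (kirillov x : g -> K^o).
Proof. by move=> c y y'; rewrite /kirillov lieDr lieZr killingDr killingZr. Qed.

Lemma kirillovC x y : kirillov x y = - kirillov y x.
Proof. by rewrite /kirillov lieC -scaleN1r killingZr mulN1r. Qed.

Lemma kirillovE x y : kirillov x y = killing [lie e, x] y.
Proof. by rewrite killing_lie. Qed.

Lemma kirillov0l y : kirillov 0 y = 0.
Proof. exact: linear_fun0 (kirillov_linear_l y). Qed.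

Lemma kirillovDl x x' y : kirillov (x + x') y = kirillov x y + kirillov x' y.
Proof. exact: linear_funD (kirillov_linear_l y). Qed.

Lemma kirillovZl c x y : kirillov (c *: x) y = c * kirillov x y.
Proof. exact: linear_funZ (kirillov_linear_l y). Qed.

Lemma kirillovBl x x' y : kirillov (x - x') y = kirillov x y - kirillov x' y.
Proof. exact: linear_funB (kirillov_linear_l y). Qed.

Lemma kirillov0r x : kirillov x 0 = 0.
Proof. exact: linear_fun0 (kirillov_linear_r x). Qed.

Lemma kirillovDr x y y' : kirillov x (y + y') = kirillov x y + kirillov x y'.
Proof. exact: linear_funD (kirillov_linear_r x). Qed.

Lemma kirillovZr c x y : kirillov x (c *: y) = c * kirillov x y.
Proof. exact: linear_funZ (kirillov_linear_r x). Qed.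

Lemma kirillovBr x y y' : kirillov x (y - y') = kirillov x y - kirillov x y'.
Proof. exact: linear_funB (kirillov_linear_r x). Qed.

Section Graded.
Variables (G : grading g) (a : int).
Hypotheses (charK : [pchar K] =i pred0) (Ge : e \in G a).

Lemma chi_homog j z : z \in G j -> a + j != 0 -> killing e z = 0.
Proof. by move=> zj; apply: (killing_homog charK Ge zj). Qed.

Lemma chi_le k z : z \in grading_le G k -> k < - a -> killing e z = 0.
Proof.
move=> zk ka; move: z zk; apply: grading_le_ind.
- by rewrite killing0r.
- by move=> y z y0 z0; rewrite killingDr y0 z0 addr0.
- by move=> j x jk xj; apply: (chi_homog xj); lia.
Qed.

Lemma kirillov_homog i j x y :
  x \in G i -> y \in G j -> a + (i + j) != 0 -> kirillov x y = 0.
Proof. by move=> xi yj; apply: chi_homog (grading_lie xi yj). Qed.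

Lemma kirillov_le k l x y : x \in grading_le G k -> y \in grading_le G l ->
  k + l < - a -> kirillov x y = 0.
Proof. by move=> xk yl; apply: chi_le (grading_le_lie xk yl). Qed.

(** B pairs g_i and g_j nontrivially only if i + j = -a. *)
Lemma kirillov_gproj i x y : x \in G i -> kirillov x y = kirillov x (gproj G (- a - i) y).
Proof.
move=> xi; apply: (@gproj_ind _ _ G (fun y => kirillov x y = kirillov x (gproj G (- a - i) y))).
- by rewrite linear0.
- by move=> u v; rewrite linearD !kirillovDr => -> ->.
move=> j; have yj := gproj_mem G j y; rewrite (gproj_homog _ yj); case: eqP => // ne.
by rewrite kirillov0r (kirillov_homog xi yj) //; apply/eqP => aij; apply: ne; lia.
Qed.

End Graded.

(** The body of [admissible_rel] with a as a parameter, so that two pairs can be taken with the same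
    a. *)
Definition admissible_at (a : int) (G : grading g) m n :=
  [/\ 1 < a,
      e \in G a,
      [/\ graded_subspace G m, graded_subspace G n,
          (grading_le G (- a) <= m)%VS, (m <= n)%VS &
          (n <= grading_lt G 0)%VS],
      forall x,
        (killing_orthogonal m x /\ exists y, x = [lie y, e]) <->
        (exists2 y, y \in n & x = [lie y, e]) &
      [/\ (n :&: centralizer e = 0)%VS,
          forall x y, x \in n -> y \in m -> [lie x, y] \in m &
          (\dim m + \dim n = \dim {:g} - \dim (centralizer e))%N]].

Lemma admissible_degree_unique (G : grading g) a b m n :
  e != 0 -> e \in G a -> admissible_at b G m n -> b = a.
Proof.
move=> e0 Ga [_ Gb _ _ _]; have := gproj_homog a Gb.
by rewrite (gproj_homog _ Ga) eqxx; case: eqP => // _ e00; rewrite e00 eqxx in e0.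
Qed.

Section AdmissibleAt.
Variables (a : int) (G : grading g) (m n : {vspace g}).
Hypothesis (adm : admissible_at a G m n).

Lemma admissible_mn : (m <= n)%VS.
Proof. by case: adm => _ _ []. Qed.

Lemma admissible_le_m x k : k <= - a -> x \in grading_le G k -> x \in m.
Proof.
by case: adm => _ _ [_ _ /subvP am _ _] _ _ ka /(subvP (grading_leS G ka)); apply: am.
Qed.

Lemma admissible_n_le : (n <= grading_le G (- 1))%VS.
Proof. by case: adm => _ _ [_ _ _ _]; rewrite grading_ltE sub0r. Qed.

Lemma admissible_lie x y : x \in n -> y \in m -> [lie x, y] \in m.
Proof. by case: adm => _ _ _ _ [_ + _]; apply. Qed.

Lemma admissible_kirillov x y : x \in n -> y \in m -> kirillov x y = 0.
Proof.
case: adm => _ _ _ A3 _ xn ym.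
have [_ /(_ (ex_intro2 _ _ x xn erefl)) [xe _]] := A3 [lie x, e].
by rewrite kirillovE lieC killingNl xe ?oppr0.
Qed.

Lemma admissible_centralizer x : x \in n -> [lie e, x] = 0 -> x = 0.
Proof.
case: adm => _ _ _ _ [nz _ _] xn ex.
by apply/eqP; rewrite -memv0 -nz memv_cap xn memv_ker adE ex eqxx.
Qed.

Lemma admissible_bracket_inj x y : x \in n -> y \in n -> [lie x, e] = [lie y, e] -> x = y.
Proof.
move=> xn yn exy; apply/eqP; rewrite -subr_eq0; apply/eqP.
by apply: admissible_centralizer; rewrite ?rpredB // lieC lieBl exy subrr oppr0.
Qed.

(** B(x, .) vanishes on m exactly when [x, e] is in m^perp; then (A3) puts x in n + g^e. *)
Lemma admissible_mem_n x : (forall y, y \in m -> kirillov x y = 0) ->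
  exists2 y, y \in n & [lie x, e] = [lie y, e].
Proof.
case: adm => _ _ _ A3 _ x0; apply/A3; split; last by exists x.
by move=> y /x0; rewrite kirillovE lieC killingNl => /eqP; rewrite oppr_eq0 => /eqP.
Qed.

Hypothesis nondeg : killing_nondegenerate g.

Lemma kirillov_nondegenerate x : x \in n -> x != 0 -> exists y, kirillov x y != 0.
Proof.
move=> xn x0; have [|y xy] := nondeg (x := [lie e, x]); last by exists y; rewrite kirillovE.
by apply: contraNneq x0 => /admissible_centralizer ->.
Qed.

(* m + g^e is the orthogonal of [n, e] = m^perp cap [g, e]. *)
Lemma kirillov_radical y : y \in n -> (forall x, x \in n -> kirillov x y = 0) -> y \in m.
Proof.
move=> yn y0; have [/memv_addP[y1 y1m [y2 y2e yE]]|ym] :=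
  boolP (y \in (m + centralizer e)%VS).
  suff y20 : y2 = 0 by rewrite yE y20 addr0.
  have y2n : y2 \in n.
    have -> : y2 = y - y1 by rewrite yE; zmod.
    by rewrite rpredB // (subvP admissible_mn).
  by apply: admissible_centralizer y2n _; move: y2e; rewrite memv_ker adE => /eqP.
(* Otherwise some t orthogonal to m + g^e has <y, t> = 1. It lies in [g, e], then in [n, e] by (A3),
   so y is not B-orthogonal to n. *)
have [t [tH yt]] := killing_separation nondeg ym.
have [|z tz] := killing_orthogonal_centralizer nondeg (t := t) (e := e).
  by move=> u ue; apply/tH/(subvP (addvSr _ _)).
have tm : killing_orthogonal m t.
  by move=> u um; rewrite killing_sym; apply/tH/(subvP (addvSl _ _)).
case: adm => _ _ _ A3 _; have [/(_ (conj tm (ex_intro _ z tz))) [x xn tx] _] := A3 t.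
have := y0 _ xn; rewrite kirillovC /kirillov killing_sym killing_lie -tx yt.
by move=> /eqP; rewrite oppr_eq0 oner_eq0.
Qed.

End AdmissibleAt.
End KirillovForm.

(** * Whittaker ideals and the Kazhdan filtration *)

Section EnvelopingComplements.
Variables (K : fieldType) (g : lieAlgType K).
Local Notation U := (envalg g).
Implicit Types (x y z : g) (u v w : U).

Lemma env_in0 : env_in (0 : g) = 0.
Proof. exact: linear0. Qed.

Lemma env_inD x y : env_in (x + y) = env_in x + env_in y.
Proof. exact: linearD. Qed.

Lemma env_inZ c x : env_in (c *: x) = c *: env_in x.
Proof. exact: linearZ. Qed.

Lemma env_ind (P : U -> Prop) : P 0 -> (forall u v, P u -> P v -> P (u + v)) ->
  (forall c u, P u -> P (c *: u)) -> P 1 -> (forall x u, P u -> P (env_in x * u)) ->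
  forall u, P u.
Proof.
move=> P0 PD PZ P1 PM u; have [t ->] := env_piP u.
have pi0 : env_pi (0 : free_alg g) = 0 by rewrite /env_pi !generic_quotient.piE.
rewrite [t]monalgE; elim/big_ind: _ => [|t1 t2|k _]; first by rewrite pi0.
  by rewrite env_piD; apply: PD.
have -> : << t@_k *g k >> = t@_k *: (<< k >> : free_alg g).
  by apply/malgP => k'; rewrite mcoeffZ !mcoeffU mulrnAr mulr1.
rewrite env_piZ; apply: PZ; case: k => s; elim: s => [|x s IHs].
  have -> : FMonom [::] = mone :> {fmonom g} by apply/eqP; rewrite fmP fm1.
  exact: P1.
have -> : << FMonom (x :: s) >> = free_gen x * << FMonom s >> :> free_alg g.
  rewrite malgM_def fgmulUU mulr1; congr (<< _ >>).
  by apply/eqP; rewrite fmP fmM fmuE.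
by rewrite env_piM; apply: PM.
Qed.

Definition env_ad x u : U := env_in x * u - u * env_in x.

Lemma env_ad_linear x : linear (env_ad x).
Proof. by move=> c u v; rewrite /env_ad commrD_subproof commrZ_subproof. Qed.

Lemma env_ad0 x : env_ad x 0 = 0.
Proof. exact: linear_fun0 (env_ad_linear x). Qed.

Lemma env_adD x u v : env_ad x (u + v) = env_ad x u + env_ad x v.
Proof. exact: linear_funD (env_ad_linear x). Qed.

Lemma env_adB x u v : env_ad x (u - v) = env_ad x u - env_ad x v.
Proof. exact: linear_funB (env_ad_linear x). Qed.

Lemma env_adZ x c u : env_ad x (c *: u) = c *: env_ad x u.
Proof. exact: linear_funZ (env_ad_linear x). Qed.

Lemma env_ad0l u : env_ad 0 u = 0.
Proof. by rewrite /env_ad env_in0 mul0r mulr0 subrr. Qed.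

Lemma env_adDl x y u : env_ad (x + y) u = env_ad x u + env_ad y u.
Proof. by rewrite /env_ad env_inD mulrDl mulrDr; zmod. Qed.

Lemma env_adZl c x u : env_ad (c *: x) u = c *: env_ad x u.
Proof. by rewrite /env_ad env_inZ -scalerAl -scalerAr scalerBr. Qed.

Lemma env_adM x u v : env_ad x (u * v) = env_ad x u * v + u * env_ad x v.
Proof. exact: commrM_subproof. Qed.

Lemma env_ad_in x y : env_ad x (env_in y) = env_in [lie x, y].
Proof. by rewrite env_in_lie. Qed.

Lemma env_ad_scalar x c : env_ad x c%:A = 0.
Proof. by rewrite /env_ad -scalerAl -scalerAr mulr1 mul1r subrr. Qed.

Lemma env_ad_lie x y u :
  env_ad x (env_ad y u) = env_ad [lie x, y] u + env_ad y (env_ad x u).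
Proof.
rewrite /env_ad env_in_lie; move: (env_in x) (env_in y) => a b.
by rewrite !mulrBr !mulrBl !mulrA; zmod.
Qed.

Lemma env_in_mul x u : env_in x * u = env_ad x u + u * env_in x.
Proof. by rewrite subrK. Qed.

End EnvelopingComplements.

(** * The left ideals I(k) and their stability *)

Section WhittakerIdeals.
Variables (K : fieldType) (g : lieAlgType K) (e : g).
Local Notation U := (envalg g).
Local Notation B := (kirillov e).
Implicit Types (x y z : g) (u v w : U) (k m : {vspace g}).

Definition shifted_in y : U := env_in y - (killing e y)%:A.

Lemma env_in_shift y : env_in y = shifted_in y + (killing e y)%:A.
Proof. by rewrite subrK. Qed.

Lemma shifted_inD x y : shifted_in (x + y) = shifted_in x + shifted_in y.
Proof. by rewrite /shifted_in env_inD killingDr scalerDl; zmod. Qed.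

Lemma shifted_inZ c x : shifted_in (c *: x) = c *: shifted_in x.
Proof. by rewrite /shifted_in env_inZ killingZr scalerBr scalerA. Qed.

Lemma env_ad_shift x y : env_ad x (shifted_in y) = shifted_in [lie x, y] + (B x y)%:A.
Proof. by rewrite /shifted_in env_adB env_ad_scalar env_ad_in subr0 subrK. Qed.

Lemma Iideal_linear k : linear_pred (fun u => u \in Iideal e k).
Proof.
split=> [|c u v Iu Iv]; first exact: rpred0.
by rewrite rpredD // -[u]mul1r scalerAl IidealM.
Qed.

Lemma Iideal_shift k y u : y \in k -> u * shifted_in y \in Iideal e k.
Proof. by move=> yk; apply/IidealM/IidealP/left_ideal_mem; exists y. Qed.

Lemma Iideal_ind k (P : U -> Prop) : P 0 -> (forall u v, P u -> P v -> P (u + v)) ->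
  (forall u v, P v -> P (u * v)) -> (forall y, y \in k -> P (shifted_in y)) ->
  forall u, u \in Iideal e k -> P u.
Proof.
move=> P0 PD PM Pk u /IidealP; elim=> // {u} [_ [y yk ->]|u v _ Pu _ Pv|a u _ Pu].
- exact: Pk.
- exact: PD.
- exact: PM.
Qed.

Lemma Iideal_mono k k' u : (k <= k')%VS -> u \in Iideal e k -> u \in Iideal e k'.
Proof.
move=> /subvP kk'; move: u; apply: Iideal_ind => [||v w|y yk]; rewrite ?rpred0 //.
- by move=> v w Iv Iw; rewrite rpredD.
- exact: IidealM.
- by rewrite -[X in X \in _]mul1r Iideal_shift ?kk'.
Qed.

(** ad x sends the generator y - chi(y) to the generator of [x, y] plus the scalar B(x, y) = 0. *)
Lemma Iideal_env_ad k x u :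
  (forall y, y \in k -> [lie x, y] \in k) -> (forall y, y \in k -> B x y = 0) ->
  u \in Iideal e k -> env_ad x u \in Iideal e k.
Proof.
(* The Leibniz rule for ad x (a u) also involves u itself, so its membership is carried along. *)
move=> xk x0 Iu; have [] : u \in Iideal e k /\ env_ad x u \in Iideal e k; last by [].
move: u Iu; apply: Iideal_ind => [|u v [Iu Iu'] [Iv Iv']|u v [Iv Iv']|y yk].
- by rewrite env_ad0 !rpred0.
- by rewrite env_adD; split; apply: rpredD.
- by rewrite env_adM; split; [|apply: rpredD]; apply: IidealM.
- split; rewrite ?env_ad_shift ?x0 // ?scale0r ?addr0 -[shifted_in _]mul1r;
    by rewrite Iideal_shift ?xk.
Qed.

(** Moving z - chi(z) to the right of y - chi(y) leaves the generator of [z, y] plus B(z, y) = 0. *)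
Lemma Iideal_mul_shift k y u :
  (forall z, z \in k -> [lie z, y] \in k) -> (forall z, z \in k -> B z y = 0) ->
  u \in Iideal e k -> u * shifted_in y \in Iideal e k.
Proof.
move=> ky k0; move: u; apply: Iideal_ind => [|u v Iu Iv|u v Iv|z zk].
- by rewrite mul0r rpred0.
- by rewrite mulrDl rpredD.
- by rewrite -mulrA IidealM.
have -> : shifted_in z * shifted_in y = shifted_in y * shifted_in z + 1 * shifted_in [lie z, y].
  have := env_ad_shift z y; rewrite k0 // scale0r addr0 mul1r => <-.
  rewrite /env_ad env_in_shift; move: (shifted_in z) (shifted_in y) => s t.
  rewrite mulrDl mulrDr -scalerAl -scalerAr mul1r mulr1.
  by zmod.
by rewrite rpredD ?Iideal_shift ?ky.
Qed.

Lemma Iideal_add_line k y u : u \in Iideal e (k + <[y]>)%VS ->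
  exists2 v, v \in Iideal e k & exists w, u = v + w * shifted_in y.
Proof.
move: u; apply: Iideal_ind => [|u u' [v Iv [w ->]] [v' Iv' [w' ->]]|c u [v Iv [w ->]]|z].
- by exists 0; rewrite ?rpred0 //; exists 0; rewrite mul0r addr0.
- by exists (v + v'); rewrite ?rpredD //; exists (w + w'); rewrite mulrDl; zmod.
- by exists (c * v); rewrite ?IidealM //; exists (c * w); rewrite mulrDr mulrA.
case/memv_addP => z1 z1k [_ /vlineP[c ->] ->].
exists (1 * shifted_in z1); first exact: Iideal_shift.
by exists c%:A; rewrite mul1r shifted_inD shifted_inZ -scalerAl mul1r.
Qed.

(** The k-invariants of U / I(m), pulled back to U. *)
Definition whittaker_inv k m u := forall x, x \in k -> env_ad x u \in Iideal e m.

Lemma whittaker_inv_linear k m : linear_pred (whittaker_inv k m).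
Proof.
split=> [x _|c u v Wu Wv x xk]; first by rewrite env_ad0 rpred0.
by rewrite env_ad_linear; apply: (Iideal_linear m).2; [apply: Wu|apply: Wv].
Qed.

End WhittakerIdeals.

(** * Kazhdan degrees modulo I(m) *)

Section KazhdanFiltration.
Variables (K : fieldType) (g : lieAlgType K) (e : g) (G : grading g) (a : int).
Variables (m n : {vspace g}).
Hypotheses (charK : [pchar K] =i pred0) (adm : admissible_at e a G m n).
Local Notation U := (envalg g).
Implicit Types (x y z : g) (u v w : U) (q j : int).

(* An element of g_j has Kazhdan degree j + a; the generators of negative or
   zero degree act on U / I(m) by scalars plus commutators, so only those of
   positive degree are needed to exhaust it. *)
Inductive kazhdan : int -> U -> Prop :=
| kazhdan_ideal q u of u \in Iideal e m : kazhdan q u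
| kazhdan_scalar q c of 0 <= q : kazhdan q c%:A
| kazhdan_add q u v of kazhdan q u & kazhdan q v : kazhdan q (u + v)
| kazhdan_mul q j x u of x \in G j & - a < j & kazhdan q u :
    kazhdan (q + (j + a)) (env_in x * u)
| kazhdan_weaken q q' u of q <= q' & kazhdan q u : kazhdan q' u.

(** Scalars and the factors allowed in [kazhdan_mul] contribute nonnegative degree, so only I(m) is
    left below 0. This is what ends the descents on the degree. *)
Lemma kazhdan_neg q u : q < 0 -> kazhdan q u -> u \in Iideal e m.
Proof.
move=> + Fu; elim: Fu => {q u} [//|q c q0|q u v _ Iu _ Iv|q j x u _ ja _ Iu|q q' u qq' _ Iu] q_lt.
- by int_lia.
- by rewrite rpredD ?Iu ?Iv.
- by rewrite IidealM // Iu //; int_lia.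
- by apply: Iu; int_lia.
Qed.

Lemma kazhdan_linear q : linear_pred (kazhdan q).
Proof.
split=> [|c u v Fu Fv]; first by apply: kazhdan_ideal; apply: rpred0.
apply: kazhdan_add => {v Fv} //.
elim: Fu => {q u} [q u Iu|q d q0|q u v _ Iu _ Iv|q j x u xj ja _ Iu|q q' u qq' _ Iu].
- apply: kazhdan_ideal; exact: linear_predZ (Iideal_linear _ _) _ _ Iu.
- by rewrite scalerA; apply: kazhdan_scalar.
- by rewrite scalerDr; apply: kazhdan_add.
- by rewrite scalerAr; apply: kazhdan_mul.
- exact: kazhdan_weaken qq' Iu.
Qed.

(** For j <= -a, x lies in m. It is commuted past the factors of u until it meets I(m) or a scalar,
    on which it acts as chi(x); this can be nonzero only for j = -a, where the shift j + a is 0. *)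
Lemma kazhdan_mull q j x u : x \in G j -> kazhdan q u -> kazhdan (q + (j + a)) (env_in x * u).
Proof.
have [a_gt1 Ge _ _ _] := adm; move=> + Fu.
elim: Fu j x => {q u} [q u Iu|q c q0|q u v _ Fu _ Fv|q i y u yi ia Fu IHu|q q' u qq' _ Fu] j x xj.
- by apply: kazhdan_ideal; apply: IidealM.
- have [ja|ja] := ltP (- a) j; first by apply: kazhdan_mul => //; apply: kazhdan_scalar.
  rewrite -scalerAr mulr1 (env_in_shift e) scalerDr; apply: kazhdan_add.
    apply: kazhdan_ideal; rewrite -[shifted_in _ _]mul1r scalerAl; apply: Iideal_shift.
    by apply: (admissible_le_m adm ja); apply: subvP (homog_le G (lexx j)) _ xj.
  have [->|ne] := eqVneq j (- a).
    by rewrite scalerA; apply: kazhdan_scalar; int_lia.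
  rewrite (chi_homog charK Ge xj) ?scale0r ?scaler0; last by int_lia.
  exact: (kazhdan_linear _).1.
- by rewrite mulrDr; apply: kazhdan_add; [apply: Fu|apply: Fv].
- have [ja|ja] := ltP (- a) j; first by apply: kazhdan_mul => //; apply: kazhdan_mul.
  have -> : env_in x * (env_in y * u) = env_in [lie x, y] * u + env_in y * (env_in x * u).
    by rewrite env_in_lie mulrBl !mulrA subrK.
  apply: kazhdan_add.
    by apply: kazhdan_weaken (IHu _ _ (grading_lie xj yi)); int_lia.
  by apply: kazhdan_weaken (kazhdan_mul yi ia (IHu _ _ xj)); int_lia.
- by apply: kazhdan_weaken (Fu _ _ xj); int_lia.
Qed.

Lemma kazhdan_ad q j x u : x \in n -> x \in G j -> kazhdan q u -> kazhdan (q + j) (env_ad x u).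
Proof.
move=> xn xj; elim=> {q u} [q u Iu|q c q0|q u v _ Fu _ Fv|q i y u yi ia Fu IHu|q q' u qq' _ Fu].
- apply: kazhdan_ideal; apply: Iideal_env_ad Iu => y ym.
    exact: (admissible_lie adm).
  exact: (admissible_kirillov adm).
- by rewrite env_ad_scalar; apply: (kazhdan_linear _).1.
- by rewrite env_adD; apply: kazhdan_add.
- rewrite env_adM env_ad_in; apply: kazhdan_add.
    have := kazhdan_mull (grading_lie xj yi) Fu; congr kazhdan; int_lia.
  have := kazhdan_mull yi IHu; congr kazhdan; int_lia.
- by apply: kazhdan_weaken Fu; int_lia.
Qed.

Lemma kazhdan_mul_shift q j y u : - a < j -> y \in n -> y \in G j -> kazhdan q u ->
  kazhdan (q + (j + a)) (u * shifted_in e y).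
Proof.
have Ge : e \in G a by case: adm.
move=> ja yn yj; elim=> {q u} [q u Iu|q c q0|q u v _ Fu _ Fv|q i x u xi ia Fu IHu|q q' u qq' _ Fu].
- apply: kazhdan_ideal; apply: Iideal_mul_shift Iu => z zm.
    by rewrite lieC rpredN (admissible_lie adm).
  by rewrite kirillovC (admissible_kirillov adm) ?oppr0.
- rewrite -scalerAl mul1r; apply: linear_predZ (kazhdan_linear _) _ _ _.
  rewrite /shifted_in (chi_homog charK Ge yj) ?scale0r ?subr0; last by int_lia.
  by rewrite -[env_in y]mulr1 -[1]scale1r; apply: kazhdan_mul => //; apply: kazhdan_scalar.
- by rewrite mulrDl; apply: kazhdan_add.
- rewrite -mulrA; have := kazhdan_mul xi ia IHu; congr kazhdan; int_lia.
- by apply: kazhdan_weaken Fu; int_lia.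
Qed.

Lemma kazhdan_exhaustive u : exists q, kazhdan q u.
Proof.
move: u; apply: env_ind => [|u v [q Fu] [q' Fv]|c u [q Fu]||x u [q Fu]].
- by exists 0; apply: (kazhdan_linear _).1.
- exists (Num.max q q'); apply: kazhdan_add; [apply: kazhdan_weaken Fu|apply: kazhdan_weaken Fv];
    by rewrite le_max lexx ?orbT.
- by exists q; apply: linear_predZ (kazhdan_linear _) _ _ Fu.
- by exists 0; rewrite -[1]scale1r; apply: kazhdan_scalar.
move: x; pose Q x := exists q', kazhdan q' (env_in x * u).
move=> x; apply: (@gproj_ind _ _ G Q) => [|y z [q1 F1] [q2 F2]|j].
- by exists 0; rewrite env_in0 mul0r; apply: (kazhdan_linear _).1.
- exists (Num.max q1 q2); rewrite env_inD mulrDl.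
  by apply: kazhdan_add; [apply: kazhdan_weaken F1|apply: kazhdan_weaken F2];
    rewrite le_max lexx ?orbT.
- by exists (q + (j + a)); apply: kazhdan_mull Fu; apply: gproj_mem.
Qed.

End KazhdanFiltration.

(** * Nested admissible pairs *)

Section NestedAdmissiblePairs.
Variables (K : fieldType) (g : lieAlgType K) (e : g) (G : grading g) (a : int).
Variables (m n m' n' : {vspace g}).
Hypotheses (charK : [pchar K] =i pred0) (nondeg : killing_nondegenerate g).
Hypotheses (adm : admissible_at e a G m n) (adm' : admissible_at e a G m' n').
Hypotheses (sub_n : lie_subalgebra n) (mm' : (m <= m')%VS) (n'n : (n' <= n)%VS).

Local Notation U := (envalg g).
Local Notation B := (kirillov e).
Local Notation F := (kazhdan e G a m).
Local Notation I := (Iideal e).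
Local Notation winv h := (whittaker_inv e h m).
Implicit Types (x y z t : g) (u v w : U) (h k : {vspace g}) (d q : int).

Let Ge : e \in G a. Proof. by case: adm. Qed.
Let a_gt1 : 1 < a. Proof. by case: adm. Qed.
Let graded_n : graded_subspace G n. Proof. by case: adm => _ _ []. Qed.
Let graded_m' : graded_subspace G m'. Proof. by case: adm' => _ _ []. Qed.
Let mn : (m <= n)%VS. Proof. exact: admissible_mn adm. Qed.
Let m'n' : (m' <= n')%VS. Proof. exact: admissible_mn adm'. Qed.
Let m'n : (m' <= n)%VS. Proof. exact: subv_trans m'n' n'n. Qed.
Let linI k := Iideal_linear e k.
Let linF q : linear_pred (F q). Proof. exact: kazhdan_linear. Qed.
Let linW h := whittaker_inv_linear e h m.

Let lie_mn x y : x \in m -> y \in n -> [lie x, y] \in m.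
Proof. by move=> xm yn; rewrite lieC rpredN (admissible_lie adm). Qed.

Let kirillov_mn x y : x \in m -> y \in n -> B x y = 0.
Proof. by move=> xm yn; rewrite kirillovC (admissible_kirillov adm) ?oppr0. Qed.

Let Im_ad x u : x \in n -> u \in I m -> env_ad x u \in I m.
Proof.
move=> xn; apply: Iideal_env_ad => y ym; first exact: (admissible_lie adm).
exact: (admissible_kirillov adm).
Qed.

Let Im_shift y u : y \in n -> u \in I m -> u * shifted_in e y \in I m.
Proof. by move=> yn; apply: Iideal_mul_shift => z zm; [apply: lie_mn|apply: kirillov_mn]. Qed.

(** Modulo I(m), z w = ad z w + chi(z) w, and ad z w has degree q + j instead of q + j + a. *)
Lemma env_in_mul_low q j z w : z \in m -> z \in G j -> F q w ->
  F (q + j) (env_in z * w - killing e z *: w).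
Proof.
move=> zm zj Fw.
have -> : env_in z * w - killing e z *: w = env_ad z w + w * shifted_in e z.
  by rewrite env_in_mul /shifted_in mulrBr -scalerAr mulr1; zmod.
apply: kazhdan_add; first by apply: (kazhdan_ad charK adm) => //; apply: (subvP mn).
exact/kazhdan_ideal/Iideal_shift.
Qed.

(* h contains every component of n of degree below -d, and part of the
   component of degree -d. *)
Definition between_degrees d h :=
  (n :&: grading_le G (- d - 1) <= h)%VS && (h <= n :&: grading_le G (- d))%VS.

Section Between.
Variables (d : int) (h : {vspace g}).
Hypotheses (d_gt0 : 0 < d) (hd : between_degrees d h).

Lemma between_n z : z \in h -> z \in n.
Proof. by case/andP: hd => _ /subvP hn /hn; rewrite memv_cap => /andP[]. Qed.

Lemma between_le z : z \in h -> z \in grading_le G (- d).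
Proof. by case/andP: hd => _ /subvP hn /hn; rewrite memv_cap => /andP[]. Qed.

Lemma mem_between z j : z \in n -> z \in grading_le G j -> j < - d -> z \in h.
Proof.
case/andP: hd => /subvP nh _ zn zj jd; apply: nh; rewrite memv_cap zn /=.
by apply: subvP (grading_leS G _) _ zj; int_lia.
Qed.

(** ad z ad x = ad [z, x] + ad x ad z, and [z, x] is in n with degrees at most -2d, hence in h. *)
Lemma whittaker_inv_ad x u : x \in n -> x \in G (- d) -> winv h u -> winv h (env_ad x u).
Proof.
move=> xn xd Wu z zh; rewrite env_ad_lie; apply: rpredD; last exact/Im_ad/Wu.
apply: Wu; have xle := subvP (homog_le G (lexx _)) _ xd.
apply: (@mem_between _ (- d + - d)); last by int_lia.
  by apply: sub_n => //; apply: between_n.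
exact: grading_le_lie (between_le zh) xle.
Qed.

(** Parts of degree below -d pair to 0 with degree d - a, so it suffices to separate x from the
    degree -d parts of elements of h. These parts are in h, as h contains n below degree -d. *)
Lemma kirillov_dual (T : {vspace g}) x : graded_subspace G T -> x \in n -> x \in G (- d) ->
  x \notin h ->
  (forall y, y \in n -> y \in G (- d) -> y \notin h -> exists2 t, t \in T & B y t != 0) ->
  exists t, [/\ t \in T, t \in G (d - a), forall z, z \in h -> B z t = 0 & B x t = 1].
Proof.
move=> gradedT xn xd xh sepT; have lt_a : - d - 1 + (d - a) < - a by int_lia.
have eq_a : - a - - d = d - a by int_lia.
have [||u uh|t [tT th xt]] :=
  @linear_form_separation _ _ _ B h (T :&: G (d - a))%VS x.
- exact: kirillov_linear_l.
- exact: kirillov_linear_r.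
- pose ud := gproj G (- d) u; have udn : ud \in n by apply: gproj_graded (between_n uh).
  have rest : u - ud \in h.
    apply: (@mem_between _ (- d - 1)); last by int_lia.
      by rewrite rpredB // between_n.
    exact/grading_le_homog/between_le.
  have [|||t tT xt] := sepT (x - ud).
  + by rewrite rpredB.
  + by rewrite rpredB // gproj_mem.
  + apply: contra xh => xuh; have -> : x = (x - ud) + u - (u - ud) by zmod.
    by rewrite rpredB // rpredD.
  have homx : x - ud \in G (- d) by rewrite rpredB // gproj_mem.
  pose t0 := gproj G (d - a) t; have t0d : t0 \in G (d - a) by apply: gproj_mem.
  exists t0; first by rewrite memv_cap t0d gproj_graded.
  have -> : x - u = (x - ud) - (u - ud) by zmod.
  rewrite kirillovBl.
  have -> : B (u - ud) t0 = 0.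
    have udl : u - ud \in grading_le G (- d - 1) by apply/grading_le_homog/between_le.
    have t0l : t0 \in grading_le G (d - a) by apply: subvP (homog_le G (lexx _)) _ t0d.
    exact: (kirillov_le charK Ge udl t0l lt_a).
  rewrite subr0; move: xt; rewrite (kirillov_gproj charK Ge _ homx).
  by rewrite eq_a.
by exists t; move: tT; rewrite memv_cap => /andP[].
Qed.

End Between.

(** * The properties carried along the induction on h *)

Definition m'_orth h y := y \in m' /\ forall z, z \in h -> B z y = 0.

Lemma m'_orth_linear h : linear_pred (m'_orth h).
Proof.
split=> [|c y z [ym yh] [zm zh]]; first by split; rewrite ?mem0v // => z _; rewrite kirillov0r.
by split=> [|u uh]; rewrite ?rpredD ?rpredZ // kirillovDr kirillovZr yh // zh // mulr0 addr0.
Qed.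

Lemma m_orth h y : (h <= n)%VS -> y \in m -> m'_orth h y.
Proof.
move=> /subvP hn ym; split; first exact: subvP mm' _ ym.
by move=> z /hn zn; apply: (admissible_kirillov adm).
Qed.

(** h contains all of n in degree -a - j < -d, the only degree that pairs with y_j. So y_j is
    B-orthogonal to n and lies in m. *)
Lemma m'_orth_gproj d h y j : 0 < d -> between_degrees d h -> m'_orth h y -> d - a < j ->
  gproj G j y \in m.
Proof.
move=> d_gt0 hd [ym yh] jd; have eq_j : - a - (- a - j) = j by int_lia.
have lt_d : - a - j < - d by int_lia.
have yjm := gproj_graded j graded_m' ym.
apply: (kirillov_radical adm nondeg); first exact: subvP m'n _ yjm.
move=> x xn; have yj := gproj_mem G j y.
rewrite kirillovC (kirillov_gproj charK Ge _ yj) -kirillovC.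
set x' := gproj G _ x; have x'n : x' \in n by apply: gproj_graded.
have x'j : x' \in G (- a - j) by apply: gproj_mem.
have := kirillov_gproj charK Ge y x'j; rewrite eq_j => <-.
have x'l : x' \in grading_le G (- a - j) by apply: subvP (homog_le G (lexx _)) _ x'j.
exact/yh/(mem_between d_gt0 hd x'n x'l).
Qed.

(** Components of y of degree above d - a are in m, which n normalizes; the others bracket with z
    into g_(<= -a), contained in m. *)
Lemma lie_m'_orth d h z y : 0 < d -> between_degrees d h -> m'_orth h y ->
  z \in n -> z \in grading_le G (- d) -> [lie z, y] \in m.
Proof.
move=> d_gt0 hd yh zn zd; rewrite -(gproj_sum G y) linear_sum /=.
apply: rpred_sum => j _; have [dj|jd] := ltP (d - a) j.
  by apply: (admissible_lie adm) => //; apply: m'_orth_gproj yh dj.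
apply: (admissible_le_m adm (k := - d + j)); first by int_lia.
exact/(grading_le_lie zd)/(subvP (homog_le G (lexx _)))/gproj_mem.
Qed.

(** An element that is h-invariant up to lower Kazhdan degree has the leading term of an h-invariant
    one, even within a left submodule M that contains I(m) and is stable under ad h. This yields
    [liftT] for left multiplication by t. *)
Definition correctable h := forall M : U -> Prop, linear_pred M ->
  (forall u v, M v -> M (u * v)) -> (forall u, u \in I m -> M u) ->
  (forall z u, z \in h -> M u -> M (env_ad z u)) ->
  forall s v, M v -> F s v ->
  (forall j z, z \in h -> z \in G j -> F (s + j - 1) (env_ad z v)) ->
  exists v', [/\ M v', winv h v', F s v' & F (s - 1) (v - v')].

Definition liftable h := forall u', (forall z, z \in h -> z \in n' -> env_ad z u' \in I m') ->
  exists2 u, winv h u & u - u' \in I m'.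

(** I(k) is I(m') for h = 0 and I(m) for h = n, which gives injectivity. *)
Definition kernel_orth h := forall k, (forall y, y \in k <-> m'_orth h y) ->
  forall u, winv h u -> u \in I m' -> u \in I k.

(** * Adding one homogeneous element to h *)

Section Extension.
Variables (d : int) (h : {vspace g}) (x : g).
Hypotheses (d_gt0 : 0 < d) (hd : between_degrees d h).
Hypotheses (xn : x \in n) (xd : x \in G (- d)).

Local Notation hx := (h + <[x]>)%VS.

Lemma mem_addl z : z \in h -> z \in hx.
Proof. exact/subvP/addvSl. Qed.

Lemma mem_addr : x \in hx.
Proof. by apply: subvP (addvSr _ _) _ _; apply: memv_line. Qed.

Lemma between_degrees_add : between_degrees d hx.
Proof.
case/andP: hd => nh hn; rewrite /between_degrees (subv_trans nh (addvSl _ _)) /=.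
by rewrite subv_add hn -memvE memv_cap xn (subvP (homog_le G (lexx _))).
Qed.

Lemma whittaker_inv_add u : winv h u -> env_ad x u \in I m -> winv hx u.
Proof.
move=> Wu xu z /memv_addP[z1 /Wu z1u [_ /vlineP[c ->] ->]].
by rewrite env_adDl env_adZl rpredD //; apply: linear_predZ (linI m) _ _ xu.
Qed.

Section Dual.
Variables (t : g).
Hypotheses (td : t \in G (d - a)) (xt : B x t = 1) (ht : forall z, z \in h -> B z t = 0).
Hypothesis hcorr : correctable h.

Variables (M : U -> Prop) (linM : linear_pred M).
Hypotheses (MM : forall u v, M v -> M (u * v)) (IM : forall u, u \in I m -> M u).
Hypothesis Mad : forall z u, z \in hx -> M u -> M (env_ad z u).

Lemma ad_surjective q u : M u -> winv h u -> F q u ->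
  exists s, [/\ M s /\ winv h s, F (q + d) s & env_ad x s - u \in I m].
Proof.
move=> Mu Wu Fu; pose W u := M u /\ winv h u.
apply: (@filtered_surjective _ charK U (fun u => u \in I m) W W F d (env_ad x)
  ( *%R (env_in t))) => //.
- exact: env_ad_linear.
- by move=> c v w; rewrite mulrDr scalerAr.
- split=> [|c v w [Mv Wv] [Mw Ww]]; first by split; [apply: linM.1|apply: (linW h).1].
  by split; [apply: linM.2|apply: (linW h).2].
- split=> [|c v w [Mv Wv] [Mw Ww]]; first by split; [apply: linM.1|apply: (linW h).1].
  by split; [apply: linM.2|apply: (linW h).2].
- by move=> p p' v; apply: kazhdan_weaken.
- by move=> p v; apply: kazhdan_neg.
- by move=> p v; apply: kazhdan_ideal.
- by move=> v; apply: IidealM.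
- by move=> v [Mv Wv]; split; [apply: Mad mem_addr Mv|apply: (whittaker_inv_ad d_gt0 hd)].
- by move=> p v; apply: (kazhdan_ad charK adm).
(* [x, t] has degree -a, so it lies in m and acts as B(x, t) = 1 up to degree p - a. *)
- move=> p v _ Fv; rewrite env_adM env_ad_in addrK.
  have zd : [lie x, t] \in G (- a).
    by have := grading_lie xd td; rewrite (_ : - d + (d - a) = - a) //; int_lia.
  have zm : [lie x, t] \in m.
    by apply: (admissible_le_m adm (lexx _)); apply: subvP (homog_le G (lexx _)) _ zd.
  have := env_in_mul_low zm zd Fv; rewrite -/(B x t) xt scale1r.
  by apply: kazhdan_weaken; int_lia.
(* t v need not be h-invariant, but for z in h the bracket [z, t] lies in m and B(z, t) = 0, so ad z
   (t v) drops in degree and [hcorr] applies. *)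
move=> p v [Mv Wv] Fv.
have tv : F (p + d) (env_in t * v).
  by have := kazhdan_mull charK adm td Fv; rewrite (_ : d - a + a = d) //; int_lia.
have [z w zh|j z zh zj|s [Ms Ws Fs Fst]] := hcorr linM MM IM _ (MM (env_in t) Mv) tv.
- exact: Mad (mem_addl zh).
- have [jd|dj] := leP j (- d); last first.
    have -> : z = 0.
      by rewrite -(gproj_le (between_le hd zh) dj) (gproj_homog _ zj) eqxx.
    by rewrite env_ad0l; apply: (linF _).1.
  rewrite env_adM env_ad_in; apply: kazhdan_add; last first.
    by apply/kazhdan_ideal/IidealM/Wv.
  have zd : [lie z, t] \in G (j + (d - a)) by apply: grading_lie.
  have zm : [lie z, t] \in m.
    apply: (admissible_le_m adm (k := j + (d - a))); first by int_lia.
    exact: subvP (homog_le G (lexx _)) _ zd.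
  have := env_in_mul_low zm zd Fv; rewrite -/(B z t) (ht zh) scale0r subr0.
  by apply: kazhdan_weaken; int_lia.
exists s; split=> //; rewrite -[s - _]opprB; exact: (linear_predN (linF _) Fst).
Qed.

End Dual.

(** Once v is corrected to an h-invariant v1, ad x v1 has degree s - d - 1, so modulo I(m) it has a
    preimage s1 of degree s - 1 under ad x, and v1 - s1 is invariant under x too. *)
Lemma correctable_add t : t \in G (d - a) -> B x t = 1 ->
  (forall z, z \in h -> B z t = 0) -> correctable h -> correctable hx.
Proof.
move=> td xt ht hcorr M linM MM IM Mad s v Mv Fv adv.
have [z w zh|j z zh|v1 [Mv1 Wv1 Fv1 Fvv1]] := hcorr M linM MM IM _ s v Mv Fv.
- exact: Mad (mem_addl zh).
- exact: adv (mem_addl zh).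
have Fxv1 : F (s - d - 1) (env_ad x v1).
  have -> : v1 = v - (v - v1) by zmod.
  rewrite env_adB; apply: linear_predB => //; first exact: adv mem_addr xd.
  by apply: kazhdan_weaken (kazhdan_ad charK adm xn xd Fvv1); int_lia.
have Mxv1 : M (env_ad x v1) by apply: Mad mem_addr Mv1.
have Wxv1 : winv h (env_ad x v1) by apply: (whittaker_inv_ad d_gt0 hd).
have [s1 [[Ms1 Ws1] Fs1 xs1]] :=
  ad_surjective td xt ht hcorr linM MM IM Mad Mxv1 Wxv1 Fxv1.
exists (v1 - s1); split.
- exact: linear_predB.
- apply: whittaker_inv_add; first exact: linear_predB (linW h) _ _ Wv1 Ws1.
  by rewrite env_adB -opprB rpredN.
- by apply: linear_predB => //; apply: kazhdan_weaken Fs1; int_lia.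
- have -> : v - (v1 - s1) = (v - v1) + s1 by zmod.
  by apply: linear_predD => //; apply: kazhdan_weaken Fs1; int_lia.
Qed.

Hypothesis xh : x \notin h.

Lemma m'_orth_vspace h' : exists k : {vspace g}, forall y, y \in k <-> m'_orth h' y.
Proof. exact: linear_pred_vspace (m'_orth_linear h'). Qed.

Lemma hx_n : (hx <= n)%VS.
Proof. by apply/subvP => z; apply: (between_n between_degrees_add). Qed.

Lemma full_dual : exists t,
  [/\ t \in G (d - a), forall z, z \in h -> B z t = 0 & B x t = 1].
Proof.
have graded_full : graded_subspace G fullv.
  rewrite /graded_subspace -[LHS](grading_full G).
  by apply: eq_bigr => j _; rewrite capfv.
have [y yn _ yh|t [_ td th xt]] := kirillov_dual d_gt0 hd graded_full xn xd xh; last by exists t.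
have [|t yt] := kirillov_nondegenerate adm nondeg yn; last by exists t; rewrite ?memvf.
by apply: contraNneq yh => ->; apply: mem0v.
Qed.

(** * Adding an element of n' *)

Section InnerExtension.
Hypotheses (xn' : x \in n') (hcorr : correctable h) (hlift : liftable h) (hker : kernel_orth h).

(** B(n', m') = 0, so k does not change. *)
Lemma m'_orth_inner y : m'_orth h y <-> m'_orth hx y.
Proof.
split=> [[ym yh]|[ym yh]]; split=> // z; last by move=> /mem_addl/yh.
move=> /memv_addP[z1 z1h [_ /vlineP[c ->] ->]].
by rewrite kirillovDl kirillovZl yh // (admissible_kirillov adm') // mulr0 addr0.
Qed.

Lemma kernel_orth_inner : kernel_orth hx.
Proof.
move=> k kP u Wu Iu; apply: hker Iu => [y|z zh]; last by apply: Wu; apply: mem_addl.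
by rewrite kP m'_orth_inner.
Qed.

(** As u' is invariant under x, ad x u lies in I(m'), hence in I(k). Surjectivity with M = I(k)
    gives a preimage s in I(k), and u - s is still a lift because k is in m'. *)
Lemma liftable_inner : liftable hx.
Proof.
move=> u' Wu'; have [|u Wu uu'] := hlift (u' := u').
  by move=> z zh zn'; apply: Wu' zn'; apply: mem_addl.
have [k kP] := m'_orth_vspace h; have [t [td th xt]] := full_dual.
have mk : (m <= k)%VS.
  apply/subvP => y ym; apply/kP/m_orth => //.
  by apply/subvP => z; apply: (between_n hd).
have km' : (k <= m')%VS by apply/subvP => y /kP[].
have xu : env_ad x u \in I k.
  apply: hker kP _ (whittaker_inv_ad d_gt0 hd xn xd Wu) _.
  have -> : env_ad x u = env_ad x (u - u') + env_ad x u' by rewrite -env_adD subrK.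
  apply: rpredD; last by apply: Wu'; rewrite ?mem_addr.
  apply: Iideal_env_ad uu' => y ym; first exact: (admissible_lie adm').
  exact: (admissible_kirillov adm').
have [q Fxu] := kazhdan_exhaustive charK adm (env_ad x u).
have [|||s [[Is Ws] _ xs]] :=
  ad_surjective td xt th hcorr (linI k) _ _ _ xu (whittaker_inv_ad d_gt0 hd xn xd Wu) Fxu.
- by move=> v w; apply: IidealM.
- by move=> v; apply: Iideal_mono.
- move=> z v zh; apply: Iideal_env_ad => y /kP yh.
    apply: subvP mk _ _; apply: (lie_m'_orth d_gt0 hd yh).
      exact: (between_n between_degrees_add zh).
    exact: (between_le between_degrees_add zh).
  by have /m'_orth_inner[_ ->] := yh.
exists (u - s).
  apply: whittaker_inv_add; first exact: linear_predB (linW h) _ _ Wu Ws.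
  by rewrite env_adB -opprB rpredN.
have -> : u - s - u' = (u - u') - s by zmod.
by apply: rpredB => //; apply: Iideal_mono km' Is.
Qed.

End InnerExtension.

(** * Adding an element dual to some y in m' *)

Section OuterExtension.
Variable y : g.
Hypotheses (ym' : y \in m') (yd : y \in G (d - a)) (xy : B x y = 1).
Hypotheses (yh : forall z, z \in h -> B z y = 0).
Hypotheses (hlift : liftable h) (hker : kernel_orth h).

Let yn : y \in n. Proof. exact: subvP m'n _ ym'. Qed.

Let lie_yle z : z \in grading_le G (- d) -> [lie z, y] \in m.
Proof.
move=> zd; apply: (admissible_le_m adm (k := - d + (d - a))); first by int_lia.
by apply: grading_le_lie zd (subvP (homog_le G (lexx _)) _ yd).
Qed.

Let xle : x \in grading_le G (- d).
Proof. exact: subvP (homog_le G (lexx _)) _ xd. Qed.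

(** The Weyl relation modulo I(m): [x, y] is in g_(<= -a), hence in m, and B(x, y) = 1. *)
Lemma env_ad_mul_shift v : env_ad x (v * shifted_in e y) - env_ad x v * shifted_in e y - v \in I m.
Proof.
rewrite env_adM env_ad_shift xy scale1r [v * (_ + _)]mulrDr mulr1.
rewrite (_ : _ - _ - _ = v * shifted_in e [lie x, y]); last by zmod.
exact/Iideal_shift/lie_yle.
Qed.

(** Unlike left multiplication by t, this one preserves the h-invariants exactly, as [z, y] lies in
    m and B(z, y) = 0 for z in h. *)
Lemma whittaker_inv_mul_shift w : winv h w -> winv h (w * shifted_in e y).
Proof.
move=> Ww z zh; rewrite env_adM env_ad_shift yh // scale0r addr0.
apply: rpredD; first exact/Im_shift/Ww.
exact/Iideal_shift/lie_yle/(between_le hd).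
Qed.

Lemma y_degree : d < a.
Proof.
have y0 : y != 0 by apply/eqP => y0; move: xy; rewrite y0 kirillov0r => /esym/eqP; rewrite oner_eq0.
have yle : y \in grading_le G (- 1) by apply: subvP (admissible_n_le adm) _ yn.
have [//|ad] := ltP d a; have lt_da : - 1 < d - a by int_lia.
have := gproj_le yle lt_da; rewrite (gproj_homog _ yd) eqxx => y00.
by rewrite y00 eqxx in y0.
Qed.

(** The defect ad x u is removed by an h-invariant s in U (y - chi(y)), which is contained in I(m')
    because y is in m'. *)
Lemma liftable_outer : liftable hx.
Proof.
move=> u' Wu'; have [|u Wu uu'] := hlift (u' := u').
  by move=> z zh zn'; apply: Wu' zn'; apply: mem_addl.
pose P v := winv h v /\ exists w, v = w * shifted_in e y.
have linP : linear_pred P.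
  split; first by split; [apply: (linW h).1|exists 0; rewrite mul0r].
  move=> c v1 v2 [W1 [w1 v1E]] [W2 [w2 v2E]]; split; first exact: (linW h).2.
  by exists (c *: w1 + w2); rewrite mulrDl -scalerAl v1E v2E.
have Wxu := whittaker_inv_ad d_gt0 hd xn xd Wu.
have [q Fxu] := kazhdan_exhaustive charK adm (env_ad x u).
have [||||||||||s [[Ws [w sE]] _ xs]] := @filtered_surjective _ charK U
  (fun u => u \in I m) (winv h) P F d (env_ad x) (fun v => v * shifted_in e y) d_gt0 (env_ad_linear x)
  _ (linI m) (linW h) linP linF _ _ _ _ _ _ _ _ _ q (env_ad x u) Wxu Fxu.
- by move=> c v w; rewrite mulrDl scalerAl.
- by move=> p p' v; apply: kazhdan_weaken.
- by move=> p v; apply: kazhdan_neg.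
- by move=> p v; apply: kazhdan_ideal.
- by move=> v [].
- by move=> v; apply: Im_shift.
- by move=> v; apply: (whittaker_inv_ad d_gt0 hd xn xd).
- by move=> p v; apply: (kazhdan_ad charK adm).
- by move=> p v _ _; apply/kazhdan_ideal/env_ad_mul_shift.
- move=> p v Wv Fv; exists (v * shifted_in e y); split.
  + by split; [apply: whittaker_inv_mul_shift|exists v].
  + have da : - a < d - a by int_lia.
    have := kazhdan_mul_shift charK adm da yn yd Fv.
    by rewrite (_ : d - a + a = d) //; int_lia.
  + by rewrite subrr; apply: (linF _).1.
exists (u - s).
  apply: whittaker_inv_add; first exact: linear_predB (linW h) _ _ Wu Ws.
  by rewrite env_adB -opprB rpredN.
have -> : u - s - u' = (u - u') - s by zmod.
by apply: rpredB => //; rewrite sE Iideal_shift.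
Qed.

(** Let k' be the orthogonal of h + <x>. An element u of I(k) is b + v (y - chi(y)) with b in I(k').
    Invariance under x puts ad x (v (y - chi(y))) in I(k'), and the Weyl relation forces v, hence u,
    into I(k'). *)
Lemma kernel_orth_outer : kernel_orth hx.
Proof.
move=> k' k'P u Wu Iu; have [k kP] := m'_orth_vspace h.
have mk' : (m <= k')%VS by apply/subvP => z zm; apply/k'P/m_orth => //; apply: hx_n.
have hdx := between_degrees_add.
(* Subtracting B(x, z) y makes z orthogonal to x as well. *)
have kk' : (k <= k' + <[y]>)%VS.
  apply/subvP => z /kP[zm zh]; rewrite (_ : z = (z - B x z *: y) + B x z *: y); last by zmod.
  apply: memv_add; last by rewrite memvZ ?memv_line.
  apply/k'P; split; first by rewrite rpredB ?rpredZ.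
  move=> w /memv_addP[w1 w1h [_ /vlineP[c ->] ->]].
  rewrite kirillovBr kirillovZr !kirillovDl !kirillovZl zh // yh // xy !add0r mulr1.
  by rewrite mulrC subrr.
have lie_xk' z : z \in k' -> [lie x, z] \in k'.
  by move=> /k'P zh; apply: subvP mk' _ _; apply: (lie_m'_orth d_gt0 hdx zh).
have xk'0 z : z \in k' -> B x z = 0 by move=> /k'P[_ ->] //; apply: mem_addr.
have k'y0 z : z \in k' -> B z y = 0.
  by move=> /k'P[zm _]; apply: (admissible_kirillov adm') => //; apply: subvP m'n' _ _.
have lie_k'y z : z \in k' -> [lie z, y] \in k'.
  move=> /k'P zo; rewrite -(gproj_sum G z); elim/big_ind: _ => [|z1 z2|j _].
  - by rewrite lie0l mem0v.
  - by rewrite lieDl; apply: rpredD.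
  have [dj|jd] := ltP (d - a) j.
    apply: subvP mk' _ _; apply: lie_mn yn.
    exact: m'_orth_gproj d_gt0 hdx zo dj.
  have zjm : gproj G j z \in m' by apply: gproj_graded zo.1.
  apply/k'P; split; first by apply: (admissible_lie adm') => //; apply: subvP m'n' _ _.
  have zjle : gproj G j z \in grading_le G (d - a).
    exact: subvP (homog_le G jd) _ (gproj_mem G j z).
  have yle : y \in grading_le G (d - a) by apply: subvP (homog_le G (lexx _)) _ yd.
  have := y_degree => da w /(between_le hdx) wd.
  (* The degrees add up to at most d - 2a, which is below -a since d < a. *)
  have lt_a : - d + (d - a + (d - a)) < - a by int_lia.
  exact: (kirillov_le charK Ge wd (grading_le_lie zjle yle) lt_a).
have Ik'_y v : v \in I k' -> v * shifted_in e y \in I k' by apply: Iideal_mul_shift.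
have Ik'_x v : v \in I k' -> env_ad x v \in I k' by apply: Iideal_env_ad.
(* Write X for ad x, T for right multiplication by y - chi(y), and work modulo I(k'). Then X T + c =
   T X + c + 1; applying X gives (X T + c + 1) X v = 0 with X v of lower degree, so X v = 0 by
   induction and (c + 1) v = 0. *)
have descent (N : nat) q (c : nat) v : q < N%:Z -> F q v ->
    env_ad x (v * shifted_in e y) + c%:R *: v \in I k' -> v \in I k'.
  elim: N q c v => [|N IHN] q c v qN Fv Iv.
    by apply: Iideal_mono mk' _; apply: kazhdan_neg Fv.
  have {}Iv : env_ad x v * shifted_in e y + c.+1%:R *: v \in I k'.
    have := Iideal_mono mk' (env_ad_mul_shift v); move: (env_ad x (v * _)) Iv => w Iw Iwv.
    have -> : env_ad x v * shifted_in e y + c.+1%:R *: v =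
      (w + c%:R *: v) - (w - env_ad x v * shifted_in e y - v).
      by rewrite mulrSr scalerDl scale1r; zmod.
    exact: rpredB.
  have Ixv : env_ad x v \in I k'.
    apply: (IHN (q + - d) c.+1); first by int_lia.
      exact: (kazhdan_ad charK adm).
    by rewrite -env_adZ -env_adD; apply: Ik'_x.
  apply: (linear_pred_unscale (linI k') (pchar0_natS charK c)).
  by have := rpredB Iv (Ik'_y _ Ixv); rewrite addrC addKr.
have [|b Ib [v uE]] := Iideal_add_line (Iideal_mono kk' (hker kP (u := u) _ Iu)).
  by move=> z zh; apply: Wu; apply: mem_addl.
have [q Fv] := kazhdan_exhaustive charK adm v.
rewrite uE; apply: rpredD => //; apply: Ik'_y.
apply: (descent `|q|%N.+1 q 0%N) => //; first by int_lia.
rewrite scale0r addr0 (_ : v * _ = u - b); last by rewrite uE; zmod.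
rewrite env_adB; apply: rpredB; last exact: Ik'_x.
by apply: Iideal_mono mk' _; apply: Wu; apply: mem_addr.
Qed.

End OuterExtension.

End Extension.

(** * Induction over the degrees of n *)

Lemma outer_dual d h x : 0 < d -> between_degrees d h ->
  (n' :&: G (- d) <= h)%VS -> x \in n -> x \in G (- d) -> x \notin h ->
  exists y, [/\ y \in m', y \in G (d - a), forall z, z \in h -> B z y = 0 & B x y = 1].
Proof.
move=> d_gt0 hd /subvP n'h xn xd xh; apply: (kirillov_dual d_gt0 hd) => // z zn zd zh.
have [//|Nz] := pselect (exists2 t, t \in m' & B z t != 0).
(* An element z of n that is B-orthogonal to m' lies in n' by (A3) and (A4), hence in h. *)
have [t tm|z' z'n' zz'] := admissible_mem_n adm' (x := z).
  by apply/eqP/negPn/negP => zt; apply: Nz; exists t.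
have : z \in n'.
  by rewrite (admissible_bracket_inj adm zn (subvP n'n _ z'n') zz').
by move=> zn'; move: zh; rewrite n'h // memv_cap zn'.
Qed.

Definition reduction_inv h := [/\ correctable h, liftable h & kernel_orth h].

Lemma reduction_inv0 : reduction_inv 0%VS.
Proof.
split=> [M linM MM IM Mad s v Mv Fv _|u' _|k kP u _].
- exists v; split=> //; last by rewrite subrr; apply: (linF _).1.
  by move=> z; rewrite memv0 => /eqP ->; rewrite env_ad0l rpred0.
- exists u'; last by rewrite subrr rpred0.
  by move=> z; rewrite memv0 => /eqP ->; rewrite env_ad0l rpred0.
- apply: Iideal_mono; apply/subvP => y ym; apply/kP; split=> // z.
  by rewrite memv0 => /eqP ->; rewrite kirillov0l.
Qed.

Lemma reduction_inv_add d h x : 0 < d -> between_degrees d h -> x \in n -> x \in G (- d) ->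
  x \notin h -> (x \in n') || (n' :&: G (- d) <= h)%VS ->
  reduction_inv h -> reduction_inv (h + <[x]>)%VS.
Proof.
move=> d_gt0 hd xn xd xh /orP[xn'|n'h] [hcorr hlift hker].
  have [t [td th xt]] := full_dual d_gt0 hd xn xd xh; split.
  - exact: (correctable_add d_gt0 hd xn xd td xt th hcorr).
  - by apply: (liftable_inner (d := d)).
  - by apply: kernel_orth_inner.
have [y [ym' yd yh xy]] := outer_dual d_gt0 hd n'h xn xd xh; split.
- exact: (correctable_add d_gt0 hd xn xd yd xy yh hcorr).
- exact: (liftable_outer d_gt0 hd xn xd ym' yd xy yh hlift).
- exact: (kernel_orth_outer d_gt0 hd xn xd ym' yd xy yh hker).
Qed.

(** In each degree the elements of n' come first: [outer_dual] provides y once n' cap g_(-d) is in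
    h. *)
Lemma reduction_inv_degree d h : 0 < d -> between_degrees d h -> reduction_inv h ->
  reduction_inv (n :&: grading_le G (- d))%VS.
Proof.
move=> d_gt0; set nd := (n :&: _)%VS.
have [N] : exists N, (\dim nd - \dim h <= N)%N by exists (\dim nd - \dim h)%N.
elim: N h => [|N IHN] h dimh hd inv; have /andP[ndh hnd] := hd.
  suff /eqP <- : h == nd by [].
  by rewrite eqEdim hnd -subn_eq0 -leqn0.
have [nd_h|/subvPn[w wnd wh]] := boolP (nd <= h)%VS.
  by have /eqP <- : h == nd by rewrite eqEsubv hnd.
suff [x [xn xd xh xn']] : exists x, [/\ x \in n, x \in G (- d), x \notin h &
    (x \in n') || (n' :&: G (- d) <= h)%VS].
  apply: (IHN (h + <[x]>)%VS).
  - suff : (\dim h < \dim (h + <[x]>))%N by int_lia.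
    rewrite (ltn_leqif (dimv_leqif_sup (addvSl _ _))) subv_add subvv /=.
    by rewrite -memvE.
  - exact: (between_degrees_add hd xn xd).
  - exact: (reduction_inv_add d_gt0 hd xn xd xh xn' inv).
have [n'h|/subvPn[x]] := boolP (n' :&: G (- d) <= h)%VS; last first.
  by rewrite memv_cap => /andP[xn' xd] xh; exists x; rewrite xn' (subvP n'n).
move: wnd; rewrite memv_cap => /andP[wn wd].
have wdn : gproj G (- d) w \in n by apply: gproj_graded.
(* Without its component of degree -d, w is in n below degree -d, hence in h; so that component is
   outside h. *)
exists (gproj G (- d) w); split; rewrite ?n'h ?orbT ?gproj_mem //.
apply: contra wh => wdh; rewrite -(subrK (gproj G (- d) w) w) rpredD //.
apply: (subvP ndh); rewrite memv_cap rpredB //.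
exact: grading_le_homog.
Qed.

Lemma reduction_inv_full : reduction_inv n.
Proof.
have [N0 N0P] := grading_le_bounded G.
(* The degree bound runs from -(N0 + 1), where g_(<= k) is zero, up to -1, which covers n. *)
have inv (i : nat) : (i <= N0)%N ->
    reduction_inv (n :&: grading_le G (- (N0.+1)%:Z + i%:Z))%VS.
  elim: i => [_|i IHi iN].
    rewrite N0P ?capv0; last by int_lia.
    exact: reduction_inv0.
  pose d := (N0 - i)%N%:Z; have d_gt0 : 0 < d by rewrite /d; int_lia.
  have -> : - (N0.+1)%:Z + i.+1%:Z = - d by rewrite /d; int_lia.
  apply: reduction_inv_degree d_gt0 _ (IHi (ltnW iN)).
  have -> : - (N0.+1)%:Z + i%:Z = - d - 1 by rewrite /d; int_lia.
  by rewrite /between_degrees subvv capvS // grading_leS //; int_lia.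
have := inv N0 (leqnn _); have -> : - (N0.+1)%:Z + N0%:Z = - 1 by int_lia.
by have /capv_idPl -> := admissible_n_le adm.
Qed.

Lemma nested_lift u' : whittaker_inv e n' m' u' ->
  exists2 u, whittaker_inv e n m u & u - u' \in I m'.
Proof.
by move=> Wu'; have [_ lift_n _] := reduction_inv_full; apply: lift_n => z _; apply: Wu'.
Qed.

(** For h = n, an element of k is in n and B-orthogonal to n, hence in m. *)
Lemma nested_kernel u : whittaker_inv e n m u -> u \in I m' -> u \in I m.
Proof.
move=> Wu Iu; have [_ _ hker] := reduction_inv_full.
have [k kP] := m'_orth_vspace n; have := hker k kP u Wu Iu; apply: Iideal_mono.
apply/subvP => y /kP[ym' yn]; apply: (kirillov_radical adm nondeg) yn.
exact: subvP m'n _ ym'.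
Qed.

End NestedAdmissiblePairs.

(** * The isomorphism of W-algebras *)

Section WalgIsomorphic.
Variables (K : fieldType) (g : lieAlgType K) (e : g).
Implicit Types (p q r : admissible_pair e).

Lemma Walg_isomorphic_refl p : Walg_isomorphic p p.
Proof. by exists id; split=> //; exists id. Qed.

Lemma Walg_isomorphic_sym p q : Walg_isomorphic p q -> Walg_isomorphic q p.
Proof.
case=> f [linf [f1 fM] [h fK hK]]; exists h; split; last by exists f.
- by move=> c a b; apply: (can_inj fK); rewrite linf !hK.
- by split=> [|a b]; apply: (can_inj fK); rewrite ?fM ?hK ?f1.
Qed.

Lemma Walg_isomorphic_trans p q r :
  Walg_isomorphic p q -> Walg_isomorphic q r -> Walg_isomorphic p r.
Proof.
case=> f [linf [f1 fM] bijf] [h [linh [h1 hM] bijh]]; exists (h \o f); split.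
- by move=> c a b /=; rewrite linf linh.
- by split=> [|a b] /=; rewrite ?f1 ?h1 ?fM ?hM.
- exact: bij_comp bijh bijf.
Qed.

Section Nested.
Variables (p p' : admissible_pair e).
Hypotheses (mm' : (adm_m p <= adm_m p')%VS) (n'n : (adm_n p' <= adm_n p)%VS).
Hypothesis lift : forall u', whittaker_inv e (adm_n p') (adm_m p') u' ->
  exists2 u, whittaker_inv e (adm_n p) (adm_m p) u & u - u' \in Iideal e (adm_m p').
Hypothesis ker : forall u, whittaker_inv e (adm_n p) (adm_m p) u ->
  u \in Iideal e (adm_m p') -> u \in Iideal e (adm_m p).

Lemma Qinv_nested u : Qpi e (adm_m p) u \in @Qinv _ _ e p -> Qpi e (adm_m p') u \in @Qinv _ _ e p'.
Proof.
move=> /QinvP Wu; apply/QinvP => x xn'.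
exact: Iideal_mono mm' (Wu x (subvP n'n _ xn')).
Qed.

Lemma Qpi_repr m (a : Qmodule e m) : Qpi e m (repr a) = a.
Proof. by rewrite /Qpi reprK. Qed.

(** Computed on the canonical representative; any other gives the same value, as I(m) is contained
    in I(m'). *)
Definition Walg_nested (a : Walg p) : Walg p'.
Proof.
apply: (@WAlg _ _ _ p' (Qpi e (adm_m p') (repr (Wval a)))).
by apply: Qinv_nested; rewrite Qpi_repr Wval_inv.
Defined.

Lemma Walg_nestedE (a : Walg p) u : Wval a = Qpi e (adm_m p) u ->
  Wval (Walg_nested a) = Qpi e (adm_m p') u.
Proof.
move=> au; apply/Qpi_eq; apply: Iideal_mono mm' _; apply/Qpi_eq.
by rewrite Qpi_repr.
Qed.

Lemma Walg_isomorphic_nested : Walg_isomorphic p p'.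
Proof.
have surj b : exists a, Walg_nested a = b.
  have [u' bu' /QinvP Wu'] := Walg_ind_subproof b.
  have [u Wu uu'] := lift Wu'; have Ru : Qpi e (adm_m p) u \in @Qinv _ _ e p by apply/QinvP.
  exists (WAlg Ru); apply: Wval_inj; rewrite (Walg_nestedE (u := u)) // bu'.
  exact/Qpi_eq.
have inj : injective Walg_nested.
  move=> a b; have [u au /QinvP Wu] := Walg_ind_subproof a.
  have [v bv /QinvP Wv] := Walg_ind_subproof b.
  move=> /(congr1 (@Wval _ _ _ _)); rewrite (Walg_nestedE au) (Walg_nestedE bv).
  move=> /Qpi_eq uv; apply: Wval_inj; rewrite au bv; apply/Qpi_eq; apply: ker uv.
  exact: linear_predB (whittaker_inv_linear _ _ _) _ _ Wu Wv.
exists Walg_nested; split.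
- move=> c a b; have [u au _] := Walg_ind_subproof a; have [v bv _] := Walg_ind_subproof b.
  apply: Wval_inj; rewrite (Walg_nestedE (u := c *: u + v)).
    by rewrite QpiD QpiZ -(Walg_nestedE au) -(Walg_nestedE bv).
  by rewrite QpiD QpiZ -au -bv.
- split; first by apply: Wval_inj; rewrite (Walg_nestedE (u := 1)).
  move=> a b; have [u au _] := Walg_ind_subproof a; have [v bv Rv] := Walg_ind_subproof b.
  apply: Wval_inj; rewrite (Walg_nestedE (u := u * v)).
    by rewrite WvalM (Walg_nestedE au) (Walg_nestedE bv) Qmul_pi //; apply: Qinv_nested.
  by rewrite WvalM au bv Qmul_pi.
- exists (fun b => sval (cid (surj b))) => [a|b]; last by case: cid.
  by apply: inj; case: cid.
Qed.

End Nested.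

Lemma admissible_e0 (a : int) (G : grading g) (m n : {vspace g}) :
  e = 0 -> admissible_at e a G m n -> n = 0%VS.
Proof.
move=> e0 adm; apply/eqP; rewrite -subv0; apply/subvP => x xn; rewrite memv0.
by rewrite (admissible_centralizer adm xn) // e0 lie0l.
Qed.

(* If the Killing form vanishes then [n, e] = [g, e] by (A3), and (A6) forces m = 0. *)
Lemma admissible_killing0 (a : int) (G : grading g) (m n : {vspace g}) :
  (forall x y : g, killing x y = 0) -> admissible_at e a G m n ->
  m = 0%VS /\ \dim n = (\dim {:g} - \dim (centralizer e))%N.
Proof.
move=> kill0 [_ _ _ A3 [nz _ dimmn]].
have imn : (ad e @: n = ad e @: fullv)%VS.
  apply/eqP; rewrite eqEsubv limgS ?subvf //=; apply/subvP => _ /memv_imgP[z _ ->].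
  have [x xn zx] : exists2 x, x \in n & [lie z, e] = [lie x, e].
    by apply/A3; split; [move=> y _; apply: kill0|exists z].
  by rewrite adE lieC zx -lieC -adE memv_img.
have dimn : \dim n = (\dim {:g} - \dim (centralizer e))%N.
  by rewrite -(limg_dim_eq nz) imn -(limg_ker_dim (ad e) fullv) capfv addKn.
split=> //; apply/eqP; rewrite -dimv_eq0; lia.
Qed.

Lemma Walg_isomorphic_comparable p p' : [pchar K] =i pred0 -> lie_simple g ->
  (adm_m p <= adm_m p')%VS -> (adm_n p' <= adm_n p)%VS ->
  (exists G, admissible_rel e G (adm_m p) (adm_n p) /\ admissible_rel e G (adm_m p') (adm_n p')) ->
  Walg_isomorphic p p'.
Proof.
move=> charK simple_g mm' n'n [G [[a adm] [b adm']]].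
rewrite -/(admissible_at e a G _ _) in adm; rewrite -/(admissible_at e b G _ _) in adm'.
have triv : (adm_m p' <= adm_m p)%VS -> (adm_n p <= adm_n p')%VS -> Walg_isomorphic p p'.
  move=> m'm nn'; apply: Walg_isomorphic_nested => // [u' Wu'|u _]; last exact: Iideal_mono.
  exists u'; last by rewrite subrr rpred0.
  by move=> x xn; apply: Iideal_mono m'm _; apply/Wu'/(subvP nn').
(* The zero vector lies in every degree, so a and b may differ; but then (A4) makes n and n'
   zero. *)
have [e0|e_neq0] := eqVneq e 0.
  apply: triv; last by rewrite (admissible_e0 e0 adm) sub0v.
  apply: subv_trans (adm_mn p') _.
  by rewrite (admissible_e0 e0 adm') sub0v.
have [nondeg|kill0] := killing_degenerate_simple simple_g; last first.
  have [m0 dimn] := admissible_killing0 kill0 adm.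
  have [m'0 dimn'] := admissible_killing0 kill0 adm'.
  apply: triv; first by rewrite m'0 sub0v.
  by have := eqEdim (adm_n p') (adm_n p); rewrite n'n dimn dimn' leqnn => /eqP ->.
have ab : b = a by apply: admissible_degree_unique adm' => //; case: adm.
rewrite {}ab in adm'; apply: Walg_isomorphic_nested => //.
- by move=> u'; apply: (nested_lift charK nondeg adm adm' (@adm_n_subalgebra _ _ _ p) mm' n'n).
- by move=> u; apply: (nested_kernel charK nondeg adm adm' (@adm_n_subalgebra _ _ _ p) mm' n'n).
Qed.

Lemma Walg_isomorphic_equivalent p p' : [pchar K] =i pred0 -> lie_simple g ->
  equivalent_pairs p p' -> Walg_isomorphic p p'.
Proof.
move=> charK simple_g [l [q [<- <-]]]; elim: l => [|l IHl] cmp.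
  exact: Walg_isomorphic_refl.
apply: (@Walg_isomorphic_trans _ (q l)); first by apply: IHl => i il; apply/cmp/ltnW.
have [G [adm adm' [[mm' _ n'n]|[m'm _ nn']]]] := cmp l (ltnSn l).
  by apply: Walg_isomorphic_comparable => //; exists G.
by apply/Walg_isomorphic_sym/Walg_isomorphic_comparable => //; exists G.
Qed.

End WalgIsomorphic.

Theorem mainTheorem3 (R : realType) (g : lieAlgType R[i]) (e : g)
    (p p' : admissible_pair e) :
  lie_simple g -> ad_nilpotent e -> equivalent_pairs p p' ->
  Walg_isomorphic p p'.
Proof.
move=> simple_g _; apply: Walg_isomorphic_equivalent => //.
exact: pchar_num.
Qed.
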